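(* Let $D$ be a domain in $\mathbb{R}^2$ and let $u$ be metaharmonic in $D$, i.e. $u$ is a real-valued $C^2(D)$ solution of $\nabla^2 u + \lambda^2 u = 0$ for some $\lambda \in \mathbb{R}\setminus\{0\}$. Then $$\tilde a(\lambda r)\,u(x) = \frac{1}{\pi r^2}\int_{B_r(x)} u(y)\,\log\frac{r}{|x-y|}\,\mathrm{d}y, \qquad \tilde a(t) = \frac{2\,[1-J_0(t)]}{t^2},$$ for every $x \in D$ and every $r>0$ with $\overline{B_r(x)} \subset D$.
   Context: $B_r(x) = \{y : |y-x| < r\}$ is the open disc; $J_0$ is the Bessel function of the first kind of order $0$. *)

(* Defs.v *)
(* MathComp + MathComp-Analysis, over an arbitrary R : realType.
   The plane R^2 is modelled as R * R (product topology = usual topology);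
   the Euclidean distance is defined explicitly below (the library norm on
   R * R is the max-norm). *)
From HB Require Import structures.
From mathcomp Require Import all_boot all_order all_algebra.
From mathcomp Require Import all_classical all_reals all_analysis.
Set Implicit Arguments. Unset Strict Implicit. Unset Printing Implicit Defensive.
Import Order.TTheory GRing.Theory Num.Theory.
Import numFieldNormedType.Exports.
Local Open Scope classical_set_scope.
Local Open Scope ring_scope.

Definition eucl_dist {R : realType} (x y : R * R) : R :=
  Num.sqrt ((y.1 - x.1) ^+ 2 + (y.2 - x.2) ^+ 2).

Definition disc {R : realType} (x : R * R) (r : R) : set (R * R) :=
  [set y | eucl_dist x y < r].

Definition e1 {R : realType} : R * R := (1, 0).
Definition e2 {R : realType} : R * R := (0, 1).
Definition partial1 {R : realType} (f : R * R -> R) : R * R -> R :=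
  fun p => 'D_e1 f p.
Definition partial2 {R : realType} (f : R * R -> R) : R * R -> R :=
  fun p => 'D_e2 f p.

Definition C2_on {R : realType} (D : set (R * R)) (u : R * R -> R) : Prop :=
  forall p, D p ->
    [/\ differentiable u p,
        differentiable (partial1 u) p,
        differentiable (partial2 u) p &
        [/\ {for p, continuous (partial1 (partial1 u))},
            {for p, continuous (partial1 (partial2 u))},
            {for p, continuous (partial2 (partial1 u))} &
            {for p, continuous (partial2 (partial2 u))}]].

Definition laplacian {R : realType} (u : R * R -> R) : R * R -> R :=
  fun p => partial1 (partial1 u) p + partial2 (partial2 u) p.

Definition metaharmonic {R : realType} (D : set (R * R)) (lambda : R)
  (u : R * R -> R) : Prop :=
  lambda != 0 /\ C2_on D u /\
  forall p, D p -> laplacian u p + lambda ^+ 2 * u p = 0.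

Definition domain {R : realType} (D : set (R * R)) : Prop :=
  open D /\ connected D /\ D !=set0.

Definition J0 {R : realType} (t : R) : R :=
  limn (series (fun k : nat => (-1) ^+ k * (t / 2) ^+ (2 * k) / (k`!%:R) ^+ 2)).

Definition atilde {R : realType} (t : R) : R := 2 * (1 - J0 t) / t ^+ 2.

Definition leb2 {R : realType} :=
  ((@lebesgue_measure R) \x (@lebesgue_measure R))%E.

(* Main.v *)
Require Import Defs.
From HB Require Import structures.
From mathcomp Require Import all_boot all_order all_algebra.
From mathcomp Require Import all_classical all_reals all_analysis.
From mathcomp Require Import measurable_realfun ring lra.
Import Order.TTheory GRing.Theory Num.Theory.
Import numFieldNormedType.Exports.
Local Open Scope classical_set_scope.
Local Open Scope ring_scope.

(** Put s = r^2, P(y) = s - |y-x|^2 and V_k = \int_{B_r(x)} P^k u. For k >= 2 the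
    function P^k vanishes to second order on the circle, so integrating along
    chords gives \int P^k Lap u = \int u Lap (P^k) without boundary terms. As
    Lap (P^k) = 4k(k-1) s P^(k-2) - 4k^2 P^(k-1), the quotients a_k of V_k by its
    value for u = 1 satisfy a_k = a_(k+1) - c / ((k+2)(k+3)) a_(k+2) with
    c = (lambda r)^2 / 4, and a_k tends to u(x) because the weights P^k
    concentrate at x. The normalized Bessel functions
    b_n = \sum_j (-c)^j n! / (j! (n+j)!) obey the same recurrence and tend to 1;
    a null sequence obeying it is zero, hence a_k = u(x) b_(k+1).
    Finally log (r/|y-x|) = 1/2 \sum_(k >= 1) (P/s)^k / k, and integrating term by
    term gives a series in the a_k that the recurrence telescopes to a multiple
    of 1 - b_0 = 1 - J_0(lambda r). *)

(** * Measure theory of discs in the plane *)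

(** Green's identity applied directly to log (r/|y-x|) would leave a point mass at x and a circle
    integral of u, because the logarithm is singular at x and its normal derivative does not vanish
    on the circle. The polynomial weights P^k avoid both, so Fubini and the one-variable fundamental
    theorem suffice. Integration by parts is free of boundary terms only from P^2 on, but the
    identity for P^2 already involves V_0 and V_1, so every moment is reached. A three-term
    recurrence alone has a two-dimensional solution space; in place of two initial values, which are
    unknown here, the behaviour as k tends to infinity selects the solution. The same identity for u
    = 1 gives the normalizing values pi s^(k+1) / (k+1), and the 4 in c is the 4 of Lap (P^k). *)

Lemma continuous_for_exprn {T : topologicalType} {R : realType} (f : T -> R) n p :
  {for p, continuous f} -> {for p, continuous (fun q => f q ^+ n)}.
Proof. by move=> cf; exact: (continuous_comp cf (@exprn_continuous R n _)). Qed.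

(** The sigma-algebra on the plane is the product one, generated by rectangles. An open set is the
    countable union of the rational boxes inside it; boxes that stick out are replaced by the empty
    set, so that the index type is all of Q^4. *)
Lemma open_measurable_plane {R : realType} (O : set (R * R)) : open O -> measurable O.
Proof.
move=> oO.
pose box (q : (rat * rat) * (rat * rat)) : set (R * R) :=
  `]ratr q.1.1, ratr q.1.2[ `*` `]ratr q.2.1, ratr q.2.2[.
have -> : O = \bigcup_q (if `[< box q `<=` O >] then box q else set0).
  apply/seteqP; split=> [p Op|p [q _]]; last first.
    by case: ifPn => // /asboolP; exact.
  have /nbhs_ballP[e /= e0 peO] : nbhs p O by rewrite openE in oO; exact: oO.
  have [q1] : exists q : rat, ratr q \in `]p.1 - e, p.1[.
    by apply: rat_in_itvoo; rewrite ltrBlDr ltrDl.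
  have [q2] : exists q : rat, ratr q \in `]p.1, p.1 + e[.
    by apply: rat_in_itvoo; rewrite ltrDl.
  have [q3] : exists q : rat, ratr q \in `]p.2 - e, p.2[.
    by apply: rat_in_itvoo; rewrite ltrBlDr ltrDl.
  have [q4] : exists q : rat, ratr q \in `]p.2, p.2 + e[.
    by apply: rat_in_itvoo; rewrite ltrDl.
  rewrite !in_itv/= => /andP[? ?] /andP[? ?] /andP[? ?] /andP[? ?].
  exists ((q1, q2), (q3, q4)) => //.
  rewrite asboolT; last first.
    move=> z [/=]; rewrite !in_itv/= => /andP[? ?] /andP[? ?]; apply: peO.
    by split; rewrite /ball/= ltr_distlC; apply/andP; split; lra.
  by split; rewrite /= in_itv/=; apply/andP.
have cq : countable [set: (rat * rat) * (rat * rat)] by exact: countableP.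
apply: countable_bigcupT_measurable => // q.
case: ifP => _; last exact: measurable0.
by apply: measurableX; exact: measurable_itv.
Qed.

Lemma continuous_measurable_plane {R : realType} (O : set (R * R)) (f : R * R -> R) :
  open O -> (forall p, O p -> {for p, continuous f}) -> measurable_fun O f.
Proof.
move=> oO cf; apply: (measurability _ (RGenOpens.measurableE R)).
move=> _ [_ [a [b ->] <-]]; apply: open_measurable_plane.
rewrite openE => p [Op /= fp]; apply: filterI.
  by move: oO; rewrite openE; exact.
by apply: cf => //; apply: open_nbhs_nbhs; split=> //; exact: interval_open.
Qed.

Section disc.
Context {R : realType}.
Implicit Types (x y : R * R) (r : R) (f : R * R -> R).

(* Minus the power of the point [y] with respect to the circle of radius [r] about [x]. *)
Definition power x r y : R := r ^+ 2 - ((y.1 - x.1) ^+ 2 + (y.2 - x.2) ^+ 2).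

Lemma discE x r : 0 < r -> disc x r = [set y | 0 < power x r y].
Proof.
move=> r0; apply/seteqP; split=> y; rewrite /disc/= /eucl_dist /power subr_gt0.
  by rewrite -[X in _ < X -> _](ger0_norm (ltW r0)) -sqrtr_sqr ltr_sqrt ?exprn_gt0.
by rewrite -[X in _ -> _ < X](ger0_norm (ltW r0)) -sqrtr_sqr ltr_sqrt ?exprn_gt0.
Qed.

Lemma continuous_power x r : continuous (power x r).
Proof.
move=> y; have c1 : {for y, continuous (fun p : R * R => p.1 - x.1)}.
  by apply: cvgB; [exact: cvg_fst|exact: cvg_cst].
have c2 : {for y, continuous (fun p : R * R => p.2 - x.2)}.
  by apply: cvgB; [exact: cvg_snd|exact: cvg_cst].
apply: cvgB; first exact: cvg_cst.
by apply: cvgD; [exact: (continuous_for_exprn _ _ _ c1)|exact: (continuous_for_exprn _ _ _ c2)].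
Qed.

Lemma open_disc x r : 0 < r -> open (disc x r).
Proof.
move=> r0; rewrite discE// -[X in open X]/(power x r @^-1` [set t | 0 < t]).
by apply: open_comp => [y _|]; [exact: continuous_power|exact: open_gt].
Qed.

Lemma measurable_disc x r : 0 < r -> measurable (disc x r).
Proof. by move=> /(open_disc x); exact: open_measurable_plane. Qed.

(** Moving [y] slightly towards the centre along the segment [g] makes the power positive. Chord
    endpoints lie on the circle, and this is how the hypotheses made on the closed disc reach
    them. *)
Lemma power_ge0_closure x r y : 0 < r -> 0 <= power x r y -> closure (disc x r) y.
Proof.
move=> r0 y0.
pose g (t : R) : R * R := (x.1 + t * (y.1 - x.1), x.2 + t * (y.2 - x.2)).
have cg : {for 1, continuous g}.
  have h (a b : R) : a + t * b @[t --> (1 : R)] --> a + 1 * b.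
    by apply: cvgD; [exact: cvg_cst|apply: cvgM; [exact: cvg_id|exact: cvg_cst]].
  exact: (cvg_pair (h _ _) (h _ _)).
have g1 : g 1 = y by rewrite /g !mul1r [x.1 + _]addrC [x.2 + _]addrC !subrK -surjective_pairing.
move=> B; rewrite -g1 => /cg /=; rewrite nbhs_simpl/= => /nbhs_ballP[e /= e0 eB].
pose d := Num.min (e / 2) (1 / 2).
have d0 : 0 < d by rewrite lt_min; apply/andP; split; lra.
have de : d <= e / 2 by rewrite ge_min lexx.
have d1 : d <= 1 / 2 by rewrite ge_min lexx orbT.
exists (g (1 - d)); split; last first.
  by apply: eB; rewrite /ball/= opprB addrCA subrr addr0 gtr0_norm//; lra.
rewrite discE//= /power /g /=; move: y0; rewrite /power.
rewrite ![_ + _ * _ - _]addrAC !subrr !add0r !exprMn -mulrDr.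
move: ((y.1 - x.1) ^+ 2 + (y.2 - x.2) ^+ 2) (addr_ge0 (sqr_ge0 (y.1 - x.1)) (sqr_ge0 (y.2 - x.2))) => q q0 y0.
have r20 : 0 < r ^+ 2 by rewrite exprn_gt0.
have : (1 - d) ^+ 2 * q <= (1 - d) ^+ 2 * r ^+ 2 by rewrite ler_wpM2l ?sqr_ge0//; lra.
have : (1 - d) ^+ 2 * r ^+ 2 < r ^+ 2.
  by rewrite gtr_pMl// expr_lt1//; lra.
lra.
Qed.

Lemma disc_box x r : 0 < r ->
  disc x r `<=` `[x.1 - r, x.1 + r] `*` `[x.2 - r, x.2 + r].
Proof.
move=> r0 y; rewrite discE//= /power => y0.
have h (u v : R) : 0 < r ^+ 2 - (u ^+ 2 + v ^+ 2) -> `|u| <= r.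
  move=> uv; rewrite -[leRHS](ger0_norm (ltW r0)) -ler_sqr ?nnegrE//.
  by rewrite !real_normK ?num_real//; have := sqr_ge0 v; lra.
have := h _ _ y0; rewrite [X in _ - X]addrC in y0; have := h _ _ y0.
rewrite !ler_distl => /andP[? ?] /andP[? ?].
by split; rewrite /= in_itv/=; apply/andP.
Qed.

Lemma compact_closure_disc x r : 0 < r -> compact (closure (disc x r)).
Proof.
move=> r0; pose K : set (R * R) := `[x.1 - r, x.1 + r] `*` `[x.2 - r, x.2 + r].
have cK : compact K by apply: compact_setX; exact: segment_compact.
apply: (subclosed_compact _ cK); first exact: closed_closure.
have : closed K by apply: compact_closed => //; exact: norm_hausdorff.
by move=> /closure_id ->; apply: closureS; exact: disc_box.
Qed.

Lemma bounded_on_closure_disc x r f : 0 < r ->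
  (forall p, closure (disc x r) p -> {for p, continuous f}) ->
  exists2 M, 0 < M & forall p, closure (disc x r) p -> `|f p| <= M.
Proof.
move=> r0 cf; have cK := compact_closure_disc x r r0.
have : compact (f @` closure (disc x r)).
  apply: continuous_compact => //; apply: continuous_in_subspaceT => p.
  by rewrite inE; exact: cf.
move=> /compact_bounded[M [_ MP]]; exists (`|M| + 1); first by rewrite ltr_pwDr.
move=> p Kp; apply: (MP (`|M| + 1)); last by exists p.
by rewrite (le_lt_trans (ler_norm _))// ltrDl.
Qed.

Lemma leb2_disc_lty x r : 0 < r -> (leb2 (disc x r) < +oo)%E.
Proof.
move=> r0.
pose K : set (R * R) := `[x.1 - r, x.1 + r] `*` `[x.2 - r, x.2 + r].
have mK : measurable K by apply: measurableX; exact: measurable_itv.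
have : (leb2 (disc x r) <= leb2 K)%E.
  apply: le_measure; rewrite ?inE//; first exact: measurable_disc.
  by move=> y yr; apply: disc_box => //.
move=> /le_lt_trans; apply; rewrite /leb2 product_measure1E//; try exact: measurable_itv.
have I_lty (a b : R) : (lebesgue_measure `[a, b] < +oo)%E.
  by rewrite lebesgue_measure_itv/=; case: ifP; rewrite -?EFinB ltry.
apply: lte_mul_pinfty; [exact: measure_ge0| |exact: I_lty].
by rewrite ge0_fin_numE ?measure_ge0//; exact: I_lty.
Qed.

Lemma integrable_disc x r f M : 0 < r ->
  measurable_fun (disc x r) f ->
  (forall p, disc x r p -> `|f p| <= M) ->
  leb2.-integrable (disc x r) (EFin \o f).
Proof.
move=> r0 mf fM; apply: measurable_bounded_integrable => //.
- exact: measurable_disc.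
- exact: leb2_disc_lty.
- exists M; split; first exact: num_real.
  by move=> N MN p /= /fM /le_trans; apply; exact: ltW.
Qed.

End disc.

(** Both orders of integration are kept: horizontal chords serve the second derivative along [e1],
    vertical chords the one along [e2]. *)
Lemma disc_fubini {R : realType} (x : R * R) (r M : R) (f : R * R -> R) : 0 < r ->
  measurable_fun (disc x r) f -> (forall p, disc x r p -> `|f p| <= M) ->
  (\int[leb2]_(p in disc x r) (f p)%:E =
    \int[lebesgue_measure]_b \int[lebesgue_measure]_(a in [set a | disc x r (a, b)]) (f (a, b))%:E)%E /\
  (\int[leb2]_(p in disc x r) (f p)%:E =
    \int[lebesgue_measure]_a \int[lebesgue_measure]_(b in [set b | disc x r (a, b)]) (f (a, b))%:E)%E.
Proof.
move=> r0 mf fM; have intf := integrable_disc x r f M r0 mf fM.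
have mD := measurable_disc x r r0.
have intf' : leb2.-integrable setT ((EFin \o f) \_ (disc x r)).
  by apply: (iffLR (integrable_mkcond _ _) intf); exact: measurable_disc.
rewrite integral_mkcond /leb2; split.
  rewrite -(integral21_prod_meas1 intf'); apply: eq_integral => b _.
  rewrite [RHS]integral_mkcond; apply: eq_integral => a _ /=.
  by rewrite /patch/= !mem_setE.
rewrite -(integral12_prod_meas1 intf'); apply: eq_integral => b _.
rewrite [RHS]integral_mkcond; apply: eq_integral => a _ /=.
by rewrite /patch/= !mem_setE.
Qed.

(** * One-variable calculus along chords *)

Lemma derivable_slice1 {R : realType} (f : R * R -> R) (p : R * R) (v : R) :
  is_derive p e1 f v -> is_derive p.1 1 (fun t => f (t, p.2)) v.
Proof.
case=> df fv.
have E : (fun h : R => h^-1 *: (((fun t => f (t, p.2)) \o shift p.1) (h *: 1) - f (p.1, p.2)))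
       = (fun h : R => h^-1 *: ((f \o shift p) (h *: e1) - f p)).
  apply/funext => h /=; rewrite -surjective_pairing; congr (_ *: (f _ - _)).
  by rewrite [RHS]surjective_pairing /= scaler0 add0r.
by split; [rewrite /derivable E|rewrite /derive E].
Qed.

Lemma derivable_slice2 {R : realType} (f : R * R -> R) (p : R * R) (v : R) :
  is_derive p e2 f v -> is_derive p.2 1 (fun t => f (p.1, t)) v.
Proof.
case=> df fv.
have E : (fun h : R => h^-1 *: (((fun t => f (p.1, t)) \o shift p.2) (h *: 1) - f (p.1, p.2)))
       = (fun h : R => h^-1 *: ((f \o shift p) (h *: e2) - f p)).
  apply/funext => h /=; rewrite -surjective_pairing; congr (_ *: (f _ - _)).
  by rewrite [RHS]surjective_pairing /= scaler0 add0r.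
by split; [rewrite /derivable E|rewrite /derive E].
Qed.

Section pointwise_derivatives.
Context {R : realType}.
Implicit Types (f g : R -> R) (t : R).

(** This and the next rules are stated for explicit [fun t => ...], so that derivatives of concrete
    expressions can be assembled as terms and simplified by [ring]. *)
Lemma is_derive_ptB f g t df dg : is_derive t 1 f df -> is_derive t 1 g dg ->
  is_derive t 1 (fun t => f t - g t) (df - dg).
Proof. exact: is_deriveB. Qed.

Lemma is_derive_ptD f g t df dg : is_derive t 1 f df -> is_derive t 1 g dg ->
  is_derive t 1 (fun t => f t + g t) (df + dg).
Proof. exact: is_deriveD. Qed.

Lemma is_derive_ptM f g t df dg : is_derive t 1 f df -> is_derive t 1 g dg ->
  is_derive t 1 (fun t => f t * g t) (df * g t + f t * dg).
Proof.
move=> df' dg'; have H := is_deriveM df' dg'.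
by rewrite addrC [df * _]mulrC; exact: H.
Qed.

Lemma is_derive_ptX f n t df : is_derive t 1 f df ->
  is_derive t 1 (fun t => f t ^+ n.+1) (n.+1%:R * f t ^+ n * df).
Proof.
elim: n => [df0|n ih df0].
  by under eq_fun do rewrite expr1; rewrite expr0 !mul1r.
have -> : n.+2%:R * f t ^+ n.+1 * df = df * f t ^+ n.+1 + f t * (n.+1%:R * f t ^+ n * df).
  by rewrite -[in LHS]addn1 natrD exprS; ring.
under eq_fun do rewrite exprS.
exact: is_derive_ptM df0 (ih df0).
Qed.

End pointwise_derivatives.

Lemma is_derive_chord_power {R : realType} (s c t : R) (n : nat) :
  is_derive t 1 (fun t => (s - (t - c) ^+ 2) ^+ n.+1)
    (- (2 * n.+1%:R) * (t - c) * (s - (t - c) ^+ 2) ^+ n).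
Proof.
have d1 : is_derive t 1 (fun t : R => t - c) (1 - 0).
  exact: is_derive_ptB (is_derive_id _ _) (is_derive_cst _ _ _).
have d2 := is_derive_ptB _ _ _ _ _ (is_derive_cst s t 1) (is_derive_ptX _ 1 _ _ d1).
have := is_derive_ptX _ n _ _ d2.
by move=> H; apply: is_derive_eq H _; rewrite /cst/=; ring.
Qed.

(* The integrand is the derivative of [phi * g' - phi' * g] for
   [phi t = (h^2 - (t - c)^2)^(k+2)], and [phi], [phi'] vanish at [c - h] and [c + h]. *)
Lemma green_chord {R : realType} (c h : R) (k : nat) (g g1 g2 : R -> R) : 0 < h ->
  (forall t, t \in `[c - h, c + h] ->
     [/\ is_derive t 1 g (g1 t), is_derive t 1 g1 (g2 t) & {for t, continuous g2}]) ->
  (\int[lebesgue_measure]_(t in `](c - h)%R, (c + h)%R[)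
     ((h ^+ 2 - (t - c) ^+ 2) ^+ k.+2 * g2 t -
      (4 * k.+2%:R * k.+1%:R * (t - c) ^+ 2 * (h ^+ 2 - (t - c) ^+ 2) ^+ k
       - 2 * k.+2%:R * (h ^+ 2 - (t - c) ^+ 2) ^+ k.+1) * g t)%R%:E = 0)%E.
Proof.
move=> h0 dg.
pose P n t := (h ^+ 2 - (t - c) ^+ 2) ^+ n.
pose f t := P k.+2 t * g2 t -
  (4 * k.+2%:R * k.+1%:R * (t - c) ^+ 2 * P k t - 2 * k.+2%:R * P k.+1 t) * g t.
rewrite -[LHS]/(\int[lebesgue_measure]_(t in `](c - h)%R, (c + h)%R[) (f t)%:E)%E.
pose F t := P k.+2 t * g1 t + 2 * k.+2%:R * ((t - c) * P k.+1 t) * g t.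
have cid t : {for t, continuous (fun t : R => t - c)}.
  by apply: cvgB; [exact: cvg_id|exact: cvg_cst].
have cP n (t : R) : {for t, continuous (P n)}.
  by apply: continuous_for_exprn; apply: cvgB; [exact: cvg_cst|exact: (continuous_for_exprn _ _ _ (cid t))].
have ccst t (a : R) : {for t, continuous (fun _ : R => a)} by exact: cvg_cst.
have cD (u : R -> R) (t v : R) : is_derive t 1 u v -> {for t, continuous u}.
  by move=> [du _]; apply/differentiable_continuous/derivable1_diffP.
have cf (t : R) : t \in `[c - h, c + h] -> {for t, continuous f}.
  move=> /dg[d1 d2 cg2]; apply: cvgB; first by apply: cvgM; [exact: (cP k.+2)|].
  apply: cvgM; last exact: cD d1.
  apply: cvgB; last by apply: cvgM; [exact: ccst|exact: cP].
  apply: cvgM; last exact: cP.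
  by apply: cvgM; [exact: ccst|exact: (continuous_for_exprn _ 2 _ (cid t))].
have dF (t : R) : t \in `[c - h, c + h] -> is_derive t 1 F (f t).
  move=> /dg[d1 d2 _].
  have dP2 := is_derive_chord_power (h ^+ 2) c t k.+1.
  have dP1 := is_derive_chord_power (h ^+ 2) c t k.
  have d0 : is_derive t 1 (fun t : R => t - c) (1 - 0).
    exact: is_derive_ptB (is_derive_id _ _) (is_derive_cst _ _ _).
  have d3 := is_derive_ptM _ _ _ _ _ (is_derive_cst (2 * k.+2%:R : R) t (1 : R))
    (is_derive_ptM _ _ _ _ _ d0 dP1).
  have := is_derive_ptD _ _ _ _ _ (is_derive_ptM _ _ _ _ _ dP2 d2)
    (is_derive_ptM _ _ _ _ _ d3 d1).
  by move=> H; apply: is_derive_eq H _; rewrite /cst/= /f /P; ring.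
have Pe n (t : R) : (t = c - h \/ t = c + h) -> P n.+1 t = 0.
  move=> th; rewrite /P (_ : h ^+ 2 - (t - c) ^+ 2 = 0) ?expr0n//.
  by case: th => ->; ring.
have Fe (t : R) : (t = c - h \/ t = c + h) -> F t = 0.
  by move=> th; rewrite /F !Pe// !(mulr0, mul0r) addr0.
have hh : c - h < c + h by lra.
have sub (t : R) : t \in `]c - h, c + h[ -> t \in `[c - h, c + h].
  exact: subset_itv_oo_cc.
have ea : c - h \in `[c - h, c + h] by rewrite in_itv/= lexx ltW.
have eb : c + h \in `[c - h, c + h] by rewrite in_itv/= lexx ltW.
have := @continuous_FTC2 R f F (c - h) (c + h) hh.
rewrite (Fe (c - h)) ?(Fe (c + h)); [|by right|by left].
rewrite sube0 => H.
(* The fundamental theorem is about the closed segment, whereas a chord of the open disc is an open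
   interval; the endpoints are null. *)
rewrite -(@integral_itv_bndoo _ _ _ _ true false); first apply: H.
- apply: continuous_in_subspaceT => t; rewrite inE => /=; exact: cf.
- split.
  + by move=> t /sub/dF[].
  + by apply: cvg_at_right_filter; exact: (cD F _ _ (dF _ ea)).
  + by apply: cvg_at_left_filter; exact: (cD F _ _ (dF _ eb)).
- by move=> t /sub/dF[_ dv]; rewrite derive1E.
- apply/measurable_EFinP; apply: open_continuous_measurable_fun; first exact: interval_open.
  by move=> t; rewrite inE => /= /sub; exact: cf.
Qed.

(** * Green's identity on the disc and weighted moments *)

Section disc_moments.
Context {R : realType}.
Implicit Types (x p : R * R) (r : R) (f g : R * R -> R).

(** Continuity is that of a function on the plane, also at points of the circle. Compactness of the
    closed disc then yields boundedness, hence integrability over the open disc. *)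
Definition closed_disc_continuous x r f :=
  forall p, closure (disc x r) p -> {for p, continuous f}.

Lemma continuous_integrable_disc x r f : 0 < r -> closed_disc_continuous x r f ->
  leb2.-integrable (disc x r) (EFin \o f).
Proof.
move=> r0 cf; have [M M0 fM] := bounded_on_closure_disc x r f r0 cf.
apply: (integrable_disc x r f M) => //; last by move=> p /subset_closure; exact: fM.
apply: continuous_measurable_plane; first exact: open_disc.
by move=> p /subset_closure; exact: cf.
Qed.

Lemma continuous_disc_fubini x r f : 0 < r -> closed_disc_continuous x r f ->
  (\int[leb2]_(p in disc x r) (f p)%:E =
    \int[lebesgue_measure]_b \int[lebesgue_measure]_(a in [set a | disc x r (a, b)]) (f (a, b))%:E)%E /\
  (\int[leb2]_(p in disc x r) (f p)%:E =
    \int[lebesgue_measure]_a \int[lebesgue_measure]_(b in [set b | disc x r (a, b)]) (f (a, b))%:E)%E.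
Proof.
move=> r0 cf; have [M M0 fM] := bounded_on_closure_disc x r f r0 cf.
apply: (disc_fubini x r M f) => //; last by move=> p /subset_closure; exact: fM.
apply: continuous_measurable_plane; first exact: open_disc.
by move=> p /subset_closure; exact: cf.
Qed.

Lemma chordE (s c t : R) : 0 < s ->
  (0 < s - (t - c) ^+ 2) = (t \in `]c - Num.sqrt s, c + Num.sqrt s[).
Proof.
move=> s0; rewrite subr_gt0 in_itv/= -ltr_distlC distrC.
by rewrite -sqrtr_sqr ltr_sqrt.
Qed.

Lemma chord_closedE (s c t : R) : 0 < s ->
  (0 <= s - (t - c) ^+ 2) = (t \in `[c - Num.sqrt s, c + Num.sqrt s]).
Proof.
move=> s0; rewrite subr_ge0 in_itv/= -ler_distlC distrC.
by rewrite -sqrtr_sqr ler_sqrt // ltW.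
Qed.

Lemma disc_chord1 x r b : 0 < r -> let s := r ^+ 2 - (b - x.2) ^+ 2 in
  [set a | disc x r (a, b)] =
  if 0 < s then `]x.1 - Num.sqrt s, x.1 + Num.sqrt s[%classic else set0.
Proof.
move=> r0 s; apply/seteqP.
have E a : disc x r (a, b) = (0 < s - (a - x.1) ^+ 2) :> Prop.
  by rewrite discE//= /power /= [X in _ - X]addrC opprD addrA.
case: ltP => s0; split=> a /=; rewrite ?E //; try by rewrite (chordE s).
by have := sqr_ge0 (a - x.1); lra.
Qed.

Lemma disc_chord2 x r a : 0 < r -> let s := r ^+ 2 - (a - x.1) ^+ 2 in
  [set b | disc x r (a, b)] =
  if 0 < s then `]x.2 - Num.sqrt s, x.2 + Num.sqrt s[%classic else set0.
Proof.
move=> r0 s; apply/seteqP.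
have E b : disc x r (a, b) = (0 < s - (b - x.2) ^+ 2) :> Prop.
  by rewrite discE//= /power /= opprD addrA.
case: ltP => s0; split=> b /=; rewrite ?E //; try by rewrite (chordE s).
by have := sqr_ge0 (b - x.2); lra.
Qed.

Lemma continuous_slice1 f a b : {for (a, b), continuous f} ->
  {for a, continuous (fun t => f (t, b))}.
Proof.
move=> cf; apply: (continuous_comp (f := fun t => (t, b)) _ cf).
exact: (cvg_pair cvg_id (cvg_cst b)).
Qed.

Lemma continuous_slice2 f a b : {for (a, b), continuous f} ->
  {for b, continuous (fun t => f (a, t))}.
Proof.
move=> cf; apply: (continuous_comp (f := fun t => (a, t)) _ cf).
exact: (cvg_pair (cvg_cst a) cvg_id).
Qed.

(** On the chord at height b the power is h^2 - (a - x.1)^2, with h the half-length of the chord. So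
    [green_chord] kills every inner integral, and lines missing the disc contribute 0. The factor
    subtracted in [F] is the second [e1]-derivative of P^(k+2). *)
Lemma green1_disc x r k f f1 f2 : 0 < r ->
  (forall p, closure (disc x r) p -> [/\ is_derive p e1 f (f1 p),
     is_derive p e1 f1 (f2 p), {for p, continuous f} & {for p, continuous f2}]) ->
  let F p := power x r p ^+ k.+2 * f2 p -
     (4 * k.+2%:R * k.+1%:R * (p.1 - x.1) ^+ 2 * power x r p ^+ k
       - 2 * k.+2%:R * power x r p ^+ k.+1) * f p in
  closed_disc_continuous x r F /\ (\int[leb2]_(p in disc x r) (F p)%:E = 0)%E.
Proof.
move=> r0 df F.
have cF : closed_disc_continuous x r F.
  move=> p /df[_ _ cf cf2].
  have c1 : {for p, continuous (fun p => p.1 - x.1)}.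
    by apply: cvgB; [exact: cvg_fst|exact: cvg_cst].
  have cst (a : R) : {for p, continuous (fun _ : R * R => a)} by exact: cvg_cst.
  have cP n := continuous_for_exprn _ n _ (continuous_power x r p).
  apply: cvgB; first by apply: cvgM; [exact: cP|exact: cf2].
  apply: cvgM; last exact: cf.
  apply: cvgB; last by apply: cvgM; [exact: cst|exact: cP].
  apply: cvgM; last exact: cP.
  by apply: cvgM; [exact: cst|exact: (continuous_for_exprn _ 2 _ c1)].
split=> //; rewrite (continuous_disc_fubini x r F r0 cF).1.
under eq_integral => b _.
  rewrite (_ : (\int[_]_(a in _) _)%E = 0%E); first over.
  rewrite disc_chord1//; set s := r ^+ 2 - _; case: ltP => s0; last by rewrite integral_set0.
  have hs : Num.sqrt s ^+ 2 = s by rewrite sqr_sqrtr// ltW.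
  have E a : power x r (a, b) = s - (a - x.1) ^+ 2.
    by rewrite /power /= [X in _ - X]addrC opprD addrA.
  rewrite -[RHS](@green_chord R x.1 (Num.sqrt s) k (fun a => f (a, b))
    (fun a => f1 (a, b)) (fun a => f2 (a, b))) ?sqrtr_gt0//.
    by apply: eq_integral => a _; rewrite /F E hs.
  move=> a; rewrite -chord_closedE// -E => /(power_ge0_closure x r _ r0)/df[d1 d2 cf cf2].
  split; [exact: (derivable_slice1 _ (a, b))|exact: (derivable_slice1 _ (a, b))|].
  exact: continuous_slice1.
by rewrite integral0.
Qed.

Lemma green2_disc x r k f f1 f2 : 0 < r ->
  (forall p, closure (disc x r) p -> [/\ is_derive p e2 f (f1 p),
     is_derive p e2 f1 (f2 p), {for p, continuous f} & {for p, continuous f2}]) ->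
  let F p := power x r p ^+ k.+2 * f2 p -
     (4 * k.+2%:R * k.+1%:R * (p.2 - x.2) ^+ 2 * power x r p ^+ k
       - 2 * k.+2%:R * power x r p ^+ k.+1) * f p in
  closed_disc_continuous x r F /\ (\int[leb2]_(p in disc x r) (F p)%:E = 0)%E.
Proof.
move=> r0 df F.
have cF : closed_disc_continuous x r F.
  move=> p /df[_ _ cf cf2].
  have c1 : {for p, continuous (fun p => p.2 - x.2)}.
    by apply: cvgB; [exact: cvg_snd|exact: cvg_cst].
  have cst (a : R) : {for p, continuous (fun _ : R * R => a)} by exact: cvg_cst.
  have cP n := continuous_for_exprn _ n _ (continuous_power x r p).
  apply: cvgB; first by apply: cvgM; [exact: cP|exact: cf2].
  apply: cvgM; last exact: cf.
  apply: cvgB; last by apply: cvgM; [exact: cst|exact: cP].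
  apply: cvgM; last exact: cP.
  by apply: cvgM; [exact: cst|exact: (continuous_for_exprn _ 2 _ c1)].
split=> //; rewrite (continuous_disc_fubini x r F r0 cF).2.
under eq_integral => a _.
  rewrite (_ : (\int[_]_(b in _) _)%E = 0%E); first over.
  rewrite disc_chord2//; set s := r ^+ 2 - _; case: ltP => s0; last by rewrite integral_set0.
  have hs : Num.sqrt s ^+ 2 = s by rewrite sqr_sqrtr// ltW.
  have E b : power x r (a, b) = s - (b - x.2) ^+ 2.
    by rewrite /power /= opprD addrA.
  rewrite -[RHS](@green_chord R x.2 (Num.sqrt s) k (fun b => f (a, b))
    (fun b => f1 (a, b)) (fun b => f2 (a, b))) ?sqrtr_gt0//.
    by apply: eq_integral => b _; rewrite /F E hs.
  move=> b; rewrite -chord_closedE// -E => /(power_ge0_closure x r _ r0)/df[d1 d2 cf cf2].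
  split; [exact: (derivable_slice2 _ (a, b))|exact: (derivable_slice2 _ (a, b))|].
  exact: continuous_slice2.
by rewrite integral0.
Qed.

Definition moment x r f (k : nat) : R :=
  Rintegral leb2 (disc x r) (fun p => power x r p ^+ k * f p).

Lemma closed_disc_continuous_moment x r f k : closed_disc_continuous x r f ->
  closed_disc_continuous x r (fun p => power x r p ^+ k * f p).
Proof.
move=> cf p /cf cfp; apply: cvgM; last exact: cfp.
exact: continuous_for_exprn (continuous_power x r p).
Qed.

Lemma RintegralD_disc x r f g : 0 < r ->
  closed_disc_continuous x r f -> closed_disc_continuous x r g ->
  Rintegral leb2 (disc x r) (fun p => f p + g p) =
  Rintegral leb2 (disc x r) f + Rintegral leb2 (disc x r) g.
Proof.
move=> r0 cf cg; apply: RintegralD; first exact: measurable_disc.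
- exact: continuous_integrable_disc.
- exact: continuous_integrable_disc.
Qed.

Lemma RintegralZ_disc x r f (a : R) : 0 < r -> closed_disc_continuous x r f ->
  Rintegral leb2 (disc x r) (fun p => a * f p) = a * Rintegral leb2 (disc x r) f.
Proof.
move=> r0 cf; apply: RintegralZl; first exact: measurable_disc.
exact: continuous_integrable_disc.
Qed.

(** In the sum of the two directional identities the squared coordinates enter only through |p-x|^2
    = r^2 - P, which leaves multiples of P^k and P^(k+1) alone. The derivatives are parameters so
    that the identity serves both [u] and the constant 1. *)
Lemma moment_laplacian x r k f f1 f11 f2 f22 : 0 < r ->
  (forall p, closure (disc x r) p ->
    [/\ is_derive p e1 f (f1 p), is_derive p e1 f1 (f11 p),
       is_derive p e2 f (f2 p) & is_derive p e2 f2 (f22 p)]) ->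
  closed_disc_continuous x r f -> closed_disc_continuous x r f11 ->
  closed_disc_continuous x r f22 ->
  moment x r (fun p => f11 p + f22 p) k.+2 =
  4 * k.+2%:R * k.+1%:R * r ^+ 2 * moment x r f k - 4 * k.+2%:R ^+ 2 * moment x r f k.+1.
Proof.
move=> r0 df cf c11 c22.
have [cF1 I1] : _ /\ _ := green1_disc x r k f f1 f11 r0 (fun p K =>
  let: And4 a b _ _ := df p K in And4 a b (cf p K) (c11 p K)).
have [cF2 I2] : _ /\ _ := green2_disc x r k f f2 f22 r0 (fun p K =>
  let: And4 _ _ a b := df p K in And4 a b (cf p K) (c22 p K)).
have R1 : Rintegral leb2 (disc x r) _ = 0 := congr1 fine I1.
have R2 : Rintegral leb2 (disc x r) _ = 0 := congr1 fine I2.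
set A := 4 * _ * _ * _; set B := 4 * _ ^+ 2.
have cZ a n g : closed_disc_continuous x r g ->
    closed_disc_continuous x r (fun p => a * (power x r p ^+ n * g p)).
  by move=> cg p K; apply: cvgM; [exact: cvg_cst|exact: closed_disc_continuous_moment].
have c0 n g : closed_disc_continuous x r g ->
    closed_disc_continuous x r (fun p => power x r p ^+ n * g p).
  exact: closed_disc_continuous_moment.
have cD g1 g2 : closed_disc_continuous x r g1 -> closed_disc_continuous x r g2 ->
    closed_disc_continuous x r (fun p => g1 p + g2 p).
  by move=> h1 h2 p K; apply: cvgD; [exact: h1|exact: h2].
have K (d1 d2 q u11 u22 u : R) : q = r ^+ 2 - (d1 + d2) ->
    q ^+ k.+2 * (u11 + u22) + (- A * (q ^+ k * u) + B * (q ^+ k.+1 * u)) =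
    q ^+ k.+2 * u11 - (4 * k.+2%:R * k.+1%:R * d1 * q ^+ k
      - 2 * k.+2%:R * q ^+ k.+1) * u +
    (q ^+ k.+2 * u22 - (4 * k.+2%:R * k.+1%:R * d2 * q ^+ k
      - 2 * k.+2%:R * q ^+ k.+1) * u).
  move=> qE; have -> : d1 = r ^+ 2 - d2 - q by rewrite qE; ring.
  by rewrite /A /B !exprS; ring.
have E : moment x r (fun p => f11 p + f22 p) k.+2 +
    (- A * moment x r f k + B * moment x r f k.+1) = 0.
  rewrite /moment -!RintegralZ_disc//; try exact: c0.
  rewrite -RintegralD_disc//; try exact: cZ.
  rewrite -RintegralD_disc//; try by [apply: c0; exact: cD|apply: cD; exact: cZ].
  rewrite -[RHS]addr0 -{1}R1 -R2 -RintegralD_disc//.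
  by apply: eq_Rintegral => p _; apply: (K ((p.1 - x.1) ^+ 2) ((p.2 - x.2) ^+ 2)).
by move: E; lra.
Qed.

(** The one explicit integration: the other moments of the constant 1 follow from it by recurrence.
    The chord lengths [w] are integrated by the substitution b = x.2 + r sin t. *)
Lemma disc_area x r : 0 < r -> Rintegral leb2 (disc x r) (fun=> 1) = pi * r ^+ 2.
Proof.
move=> r0; have c1 : closed_disc_continuous x r (fun=> 1) by move=> p _; exact: cvg_cst.
pose w (b : R) := 2 * Num.sqrt (r ^+ 2 - (b - x.2) ^+ 2).
rewrite /Rintegral (continuous_disc_fubini x r _ r0 c1).1.
have r2 : Num.sqrt (r ^+ 2) = r by rewrite sqrtr_sqr ger0_norm// ltW.
have r20 : 0 < r ^+ 2 by rewrite exprn_gt0.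
have cs (b : R) : {for b, continuous (fun b => r ^+ 2 - (b - x.2) ^+ 2)}.
  apply: cvgB; first exact: cvg_cst.
  apply: (continuous_for_exprn (fun b => b - x.2) 2 b).
  by apply: cvgB; [exact: cvg_id|exact: cvg_cst].
have cw : continuous w.
  move=> b; apply: cvgM; first exact: cvg_cst.
  exact: (continuous_comp (cs b) (@sqrt_continuous R _)).
transitivity (fine (\int[lebesgue_measure]_(b in `](x.2 - r)%R, (x.2 + r)%R[) (w b)%:E)).
  congr fine; rewrite [RHS]integral_mkcond; apply: eq_integral => b _.
  rewrite integral_cst; last by rewrite disc_chord1//; case: ifP.
  rewrite mul1e disc_chord1// /patch mem_setE.
  have -> : (b \in `]x.2 - r, x.2 + r[) = (0 < r ^+ 2 - (b - x.2) ^+ 2).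
    by rewrite (chordE _ _ _ r20) r2.
  case: ifP => s0; last by rewrite measure0.
  have L (u v : R) : u < v -> lebesgue_measure `]u, v[%classic = (v - u)%:E.
    by move=> uv; rewrite lebesgue_measure_itv/= lte_fin uv EFinB.
  etransitivity; first apply: L; last by rewrite /w; congr EFin; ring.
  by have : 0 < Num.sqrt (r ^+ 2 - (b - x.2) ^+ 2); [rewrite sqrtr_gt0|lra].
rewrite -(@integral_itv_bndoo _ _ _ _ true false); last first.
  by apply/measurable_EFinP; apply: measurable_funTS; exact: continuous_measurable_fun.
pose F (t : R) := x.2 + r * sin t.
pose G (t : R) := r * cos t.
have dF (t : R) : is_derive t 1 F (G t).
  have H := is_derive_ptD _ _ _ _ _ (is_derive_cst x.2 t (1 : R))
    (is_derive_ptM _ _ _ _ _ (is_derive_cst r t (1 : R)) (is_derive_sin t)).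
  by apply: is_derive_eq H _; rewrite /G /cst; ring.
have F'E : derive1 F = G by apply/funext => t; rewrite derive1E; case: (dF t).
have cG : continuous G.
  by move=> t; apply: cvgM; [exact: cvg_cst|exact: continuous_cos].
have cF : continuous F.
  by move=> t; apply: cvgD; [exact: cvg_cst|apply: cvgM; [exact: cvg_cst|exact: continuous_sin]].
have pi0 : - (pi / 2) < pi / 2 :> R by have := pi_gt0 R; lra.
have FE : (x.2 - r = F (- (pi / 2))) * (x.2 + r = F (pi / 2)).
  by split; rewrite /F ?sinN sin_pihalf; ring.
rewrite !FE integration_by_substitution_increasing ?F'E; last 7 first.
- exact: ltW.
- by move=> s t sI tI st; rewrite /F ltrD2l ltr_pM2l// ltr_sin.
- by move=> t _; exact: cG.
- by apply/cvg_ex; exists (G (- (pi / 2))); apply: cvg_at_right_filter; exact: cG.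
- by apply/cvg_ex; exists (G (pi / 2)); apply: cvg_at_left_filter; exact: cG.
- split; [by move=> t _; case: (dF t)| |].
    by apply: cvg_at_right_filter; exact: cF.
  by apply: cvg_at_left_filter; exact: cF.
- exact: continuous_subspaceT.
pose f (t : R) := 2 * r ^+ 2 * cos t ^+ 2.
(* A primitive of [f], since 1 + cos^2 - sin^2 = 2 cos^2. *)
pose H (t : R) := r ^+ 2 * (t + sin t * cos t).
have dH (t : R) : is_derive t 1 H (f t).
  have D := is_derive_ptM _ _ _ _ _ (is_derive_cst (r ^+ 2) t (1 : R))
    (is_derive_ptD _ _ _ _ _ (is_derive_id t (1 : R))
      (is_derive_ptM _ _ _ _ _ (is_derive_sin t) (is_derive_cos t))).
  have h : sin t ^+ 2 = 1 - cos t ^+ 2 by rewrite -(cos2Dsin2 t); ring.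
  by apply: is_derive_eq D _; rewrite /f /cst; ring: h.
have cH : continuous H.
  by move=> t; apply/differentiable_continuous/derivable1_diffP; case: (dH t).
transitivity (fine (\int[lebesgue_measure]_(t in `[(- (pi / 2))%R, (pi / 2)%R]) (f t)%:E)).
  congr fine; apply: eq_integral => t; rewrite inE /= in_itv/= => tI; congr EFin.
  rewrite /w /F /G /f !fctE /= addrAC subrr add0r.
  rewrite (_ : r ^+ 2 - (r * sin t) ^+ 2 = (r * cos t) ^+ 2); last first.
    by rewrite !exprMn -[cos t ^+ 2](addrK (sin t ^+ 2)) cos2Dsin2; ring.
  rewrite sqrtr_sqr ger0_norm; first by ring.
  by apply: mulr_ge0; [exact: ltW|exact: cos_ge0_pihalf].
rewrite (@continuous_FTC2 R f H); last 4 first.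
- exact: pi0.
- apply: continuous_subspaceT => t.
  exact: (cvgM (cvg_cst _) (continuous_for_exprn (@cos R) 2 t (@continuous_cos R t))).
- split; [by move=> t _; case: (dH t)| |].
    by apply: cvg_at_right_filter; exact: cH.
  by apply: cvg_at_left_filter; exact: cH.
- by move=> t _; rewrite derive1E; case: (dH t).
by rewrite /= /H sinN cosN cos_pihalf; field.
Qed.

End disc_moments.

(** * The recurrence and Bessel functions *)

Section three_term_recurrence.
Context {R : realType}.

(** Since the sum of 1/((i+1)(i+2)) over i >= n is 1/(n+1), following the recurrence from [n] to
    infinity, where [d] vanishes, bounds |d n| by C/(n+1) times any bound of the tail. Far out this
    factor is at most 1/2, so a tail bound can be halved forever. *)
Lemma recurrence_cvg0_eq0 (d : nat -> R) (C : R) : 0 <= C ->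
  (forall n, `|d n - d n.+1| <= C / (n.+1%:R * n.+2%:R) * `|d n.+2|) ->
  d @ \oo --> 0 -> forall n, d n = 0.
Proof.
move=> C0 rec d0.
pose K := (Num.truncn (2 * C)).+1.
have CK n : (K <= n)%N -> C / n.+1%:R <= 1 / 2.
  move=> Kn; rewrite ler_pdivrMr// -subr_ge0.
  have : 2 * C < K%:R by exact: truncnS_gt.
  have : K%:R <= n.+1%:R :> R by rewrite ler_nat leqW.
  by lra.
have [B B0 dB] : exists2 B, 0 <= B & forall n, (K <= n)%N -> `|d n| <= B.
  have cd : cvgn d by apply/cvg_ex; exists 0.
  have [M [_ MP]] := cvg_seq_bounded cd.
  exists (`|M| + 1); first by rewrite addr_ge0.
  by move=> n _; apply: MP => //; rewrite (le_lt_trans (ler_norm _))// ltrDl.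
have halve m : forall n, (K <= n)%N -> `|d n| <= B / 2 ^+ m.
  elim: m => [n Kn|m ih n Kn]; first by rewrite expr0 divr1 dB.
  set E := B / 2 ^+ m; have E0 : 0 <= E by rewrite divr_ge0// exprn_ge0.
  (* Each step costs E C / ((i+1)(i+2)), a difference of consecutive reciprocals, so the costs
     telescope. *)
  have tel l : `|d n| <= `|d (n + l)%N| + E * C * (n.+1%:R^-1 - (n + l).+1%:R^-1).
    elim: l => [|l ihl]; first by rewrite addn0 subrr mulr0 addr0.
    apply: (le_trans ihl).
    have /= h := rec (n + l)%N.
    have h2 : `|d (n + l).+2| <= E by apply: ih; rewrite -!addnS (leq_trans Kn)// leq_addr.
    have c0 : 0 <= C / ((n + l).+1%:R * (n + l).+2%:R) :> R by rewrite divr_ge0// mulr_ge0.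
    have h3 := ler_wpM2l c0 h2.
    have h4 := ler_normD (d (n + l)%N - d (n + l).+1) (d (n + l).+1).
    rewrite subrK in h4.
    have E1 : C / ((n + l).+1%:R * (n + l).+2%:R) * E =
        E * C * ((n + l).+1%:R^-1 - (n + l).+2%:R^-1).
      rewrite -[(n + l).+2]addn1 natrD.
      have : 0 < (n + l).+1%:R :> R by rewrite ltr0n.
      move: (n + l).+1%:R => a a0; field.
      by rewrite !gt_eqF //; lra.
    have := le_trans h h3; rewrite E1 addnS !mulrBr.
    move: (E * C * _) (E * C * _) (E * C * _) `|_| `|_| `|_| h4 => *.
    lra.
  have le l : `|d n| <= `|d (n + l)%N| + B / 2 ^+ m.+1.
    apply: (le_trans (tel l)); rewrite lerD2l.
    have -> : B / 2 ^+ m.+1 = E * (1 / 2) by rewrite /E exprS; field; rewrite expf_neq0.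
    rewrite -mulrA ler_wpM2l//; apply: le_trans (CK _ Kn).
    by rewrite ler_wpM2l// gerBl invr_ge0.
  have cl : (fun l => `|d (n + l)%N| + B / 2 ^+ m.+1) @ \oo --> 0 + B / 2 ^+ m.+1.
    apply: cvgD; last exact: cvg_cst.
    rewrite -(normr0 R); apply: cvg_norm.
    have -> : (fun l => d (n + l)%N) = (fun l => d (l + n)%N).
      by apply/funext => l; rewrite addnC.
    by rewrite (cvg_shiftn n d (nbhs (0 : R))).
  rewrite -[leRHS]add0r -(cvg_lim _ cl)//; apply: limr_ge; first by apply/cvg_ex; eexists; exact: cl.
  exact: nearW.
have tail n : (K <= n)%N -> d n = 0.
  move=> Kn; apply/eqP; rewrite -normr_le0.
  have cl : (fun m => B * (1 / 2) ^+ m) @ \oo --> B * 0.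
    by apply: cvgM; [exact: cvg_cst|apply: cvg_expr; rewrite ger0_norm; lra].
  rewrite -(mulr0 B) -(cvg_lim _ cl)//; apply: limr_ge; first by apply/cvg_ex; eexists; exact: cl.
  by apply: nearW => m; rewrite expr_div_n expr1n mul1r; exact: halve.
(* From the vanishing tail the recurrence is run backwards: two consecutive zeros force the
   preceding term to be zero. *)
have down j : forall n, (K <= n + j)%N -> d n = 0.
  elim: j => [n|j ih n Kn]; first by rewrite addn0; exact: tail.
  have h1 : d n.+1 = 0 by apply: ih; rewrite addSnnS.
  have h2 : d n.+2 = 0 by apply: ih; rewrite addSn leqW// addSnnS.
  by have := rec n; rewrite h1 h2 normr0 mulr0 subr0 normr_le0 => /eqP.
by move=> n; apply: (down K); rewrite leq_addl.
Qed.

End three_term_recurrence.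

Section normalized_bessel.
Context {R : realType}.
Implicit Types (c : R) (n j N : nat).

(** For c = z^2/4 the series sums to n! (2/z)^n J_n(z). The normalization makes the term j = 0 equal
    to 1 for every [n], and no power of z has to be divided out. *)
Definition bessel_coef c n j : R := (- c) ^+ j * n`!%:R / (j`!%:R * (n + j)`!%:R).
Definition bessel c n : R := limn (series (bessel_coef c n)).

Let fact0 n : n`!%:R != 0 :> R.
Proof. by rewrite pnatr_eq0 -lt0n fact_gt0. Qed.

Lemma normr_bessel_coef c n j : `|bessel_coef c n j| <= exp_coeff `|c| j.
Proof.
rewrite /bessel_coef /exp_coeff /= !normrM normfV normrX normrN !normr_nat.
rewrite -mulrA ler_wpM2l ?exprn_ge0//.
rewrite normrM !normr_nat invfM mulrCA ger_pMr ?invr_gt0 ?ltr0n ?fact_gt0//.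
by rewrite ler_pdivrMr ?ltr0n ?fact_gt0// mul1r ler_nat leq_fact// leq_addr.
Qed.

Lemma cvg_bessel c n : series (bessel_coef c n) @ \oo --> bessel c n.
Proof.
apply: normed_cvg; apply: series_le_cvg (is_cvg_series_exp_coeff `|c|) => j.
- exact: normr_ge0.
- by rewrite /exp_coeff /= divr_ge0// exprn_ge0.
- exact: normr_bessel_coef.
Qed.

(** The ratio of the two coefficients on the left is (n+1)/(n+j+2), so their difference carries a
    factor (j+1)/(n+j+2), whose numerator lowers (j+1)! to j!. Summed over j, this is J_n + J_(n+2)
    = (2(n+1)/z) J_(n+1). *)
Lemma bessel_coef_rec c n j : bessel_coef c n j.+1 - bessel_coef c n.+1 j.+1 =
  - c / (n.+1%:R * n.+2%:R) * bessel_coef c n.+2 j.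
Proof.
rewrite /bessel_coef.
have -> : (n + j.+1)`! = (n + j).+1`! by rewrite addnS.
have -> : (n.+1 + j.+1)`! = ((n + j).+2 * (n + j).+1`!)%N by rewrite addSnnS !addnS factS.
have -> : (n.+2 + j)`! = ((n + j).+2 * (n + j).+1`!)%N by rewrite !addSn factS.
have -> : n.+2`! = (n.+2 * n.+1 * n`!)%N by rewrite !factS mulnA.
rewrite (factS n) (factS j).
move: n`! (n + j).+1`! j`! (fact0 n) (fact0 (n + j).+1) (fact0 j) => A D B.
rewrite !natrM exprS; move: (A%:R : R) (D%:R : R) (B%:R : R) => a d b a0 d0 b0.
have nj : (n + j).+2%:R = n.+1%:R + j.+1%:R :> R by rewrite -natrD addSnnS !addnS.
have n2 : n.+2%:R = n.+1%:R + 1 :> R by rewrite natr1.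
have : 0 < n.+1%:R :> R by rewrite ltr0n.
have : 0 < j.+1%:R :> R by rewrite ltr0n.
rewrite nj n2; move: (n.+1%:R : R) (j.+1%:R : R) => m l l0 m0; field.
by rewrite b0 d0 !gt_eqF//; lra.
Qed.

Lemma bessel_rec c n : bessel c n - bessel c n.+1 =
  - c / (n.+1%:R * n.+2%:R) * bessel c n.+2.
Proof.
(* One more term is taken on the left: both terms of index 0 equal 1 and cancel. *)
have S N : series (bessel_coef c n) N.+1 - series (bessel_coef c n.+1) N.+1 =
    - c / (n.+1%:R * n.+2%:R) * series (bessel_coef c n.+2) N.
  rewrite /series/=; elim: N => [|N ih].
    rewrite !big_nat1 big_geq// mulr0 /bessel_coef !expr0 !mul1r !addn0.
    by rewrite !divff// subrr.
  rewrite big_nat_recr//= [X in _ - X]big_nat_recr//= [in RHS]big_nat_recr//=.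
  by rewrite mulrDr -ih -bessel_coef_rec; ring.
have l1 : (fun N => series (bessel_coef c n) N.+1 - series (bessel_coef c n.+1) N.+1) @ \oo
    --> bessel c n - bessel c n.+1.
  by apply: cvgB; rewrite (cvg_shiftS (series _) (nbhs (_ : R))); exact: cvg_bessel.
have l2 : (fun N => - c / (n.+1%:R * n.+2%:R) * series (bessel_coef c n.+2) N) @ \oo
    --> - c / (n.+1%:R * n.+2%:R) * bessel c n.+2.
  by apply: cvgM; [exact: cvg_cst|exact: cvg_bessel].
rewrite -(cvg_lim _ l1)// -(cvg_lim _ l2)//; congr (lim (_ @ \oo)).
exact/funext.
Qed.

(** For j >= 1 the quotient n!/(n+j)! is at most 1/((n+1) j!) times j!, that is 1/(n+1), so the
    series without its leading 1 is dominated by the exponential series divided by n+1. *)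
Lemma bessel_near1 c n : `|bessel c n - 1| <= expR `|c| / n.+1%:R.
Proof.
have S N : `|series (bessel_coef c n) N.+1 - 1| <= series (exp_coeff `|c|) N.+1 / n.+1%:R.
  have -> : series (bessel_coef c n) N.+1 - 1 = \sum_(0 <= j < N) bessel_coef c n j.+1.
    rewrite /series/= big_nat_recl//= {1}/bessel_coef expr0 mul1r addn0 (_ : 0`!%:R = 1 :> R)// mul1r divff//.
    by rewrite addrAC subrr add0r.
  apply: (le_trans (ler_norm_sum _ _ _)).
  have -> : series (exp_coeff `|c|) N.+1 / n.+1%:R =
     n.+1%:R^-1 + \sum_(0 <= j < N) exp_coeff `|c| j.+1 / n.+1%:R.
    rewrite /series/= big_nat_recl//= {1}/exp_coeff /= expr0 (_ : 0`!%:R = 1 :> R)// divr1 mulrDl mul1r.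
    by rewrite mulr_suml.
  apply: (@le_trans _ _ (\sum_(0 <= j < N) exp_coeff `|c| j.+1 / n.+1%:R)).
    apply: ler_sum => j _.
    rewrite /bessel_coef /exp_coeff /= !normrM normfV normrX normrN !normr_nat.
    rewrite -!mulrA ler_wpM2l ?exprn_ge0//.
    rewrite normrM !normr_nat invfM mulrCA ler_wpM2l//.
    rewrite ler_pdivrMr ?ltr0n ?fact_gt0// ler_pdivlMl ?ltr0n// -natrM -factS.
    by rewrite ler_nat leq_fact// addnS ltnS leq_addr.
  by rewrite lerDr invr_ge0.
have l1 : (fun N => `|series (bessel_coef c n) N.+1 - 1|) @ \oo --> `|bessel c n - 1|.
  apply: cvg_norm; apply: cvgB; last exact: cvg_cst.
  by rewrite (cvg_shiftS (series _) (nbhs (_ : R))); exact: cvg_bessel.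
have l2 : (fun N => series (exp_coeff `|c|) N.+1 / n.+1%:R) @ \oo --> expR `|c| / n.+1%:R.
  apply: cvgM; last exact: cvg_cst.
  by rewrite (cvg_shiftS (series _) (nbhs (_ : R))); exact: is_cvg_series_exp_coeff.
rewrite -(cvg_lim _ l1)// -(cvg_lim _ l2)//; apply: ler_lim.
- by apply/cvg_ex; eexists; exact: l1.
- by apply/cvg_ex; eexists; exact: l2.
- by apply: nearW => N; exact: S.
Qed.

Lemma cvg_bessel_index c : bessel c @ \oo --> (1 : R).
Proof.
have l : (fun n => expR `|c| * n.+1%:R^-1) @ \oo --> expR `|c| * 0.
  by apply: cvgM; [exact: cvg_cst|exact: cvg_harmonic].
have lo : (fun n => 1 - expR `|c| * n.+1%:R^-1) @ \oo --> (1 : R).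
  by rewrite -[X in _ --> X]subr0 -(mulr0 (expR `|c|)); apply: cvgB; [exact: cvg_cst|exact: l].
have hi : (fun n => 1 + expR `|c| * n.+1%:R^-1) @ \oo --> (1 : R).
  by rewrite -[X in _ --> X]addr0 -(mulr0 (expR `|c|)); apply: cvgD; [exact: cvg_cst|exact: l].
apply: squeeze_cvgr lo hi; apply: nearW => n.
by rewrite -ler_distlC distrC bessel_near1.
Qed.

Lemma J0E (t : R) : J0 t = bessel (t ^+ 2 / 4) 0.
Proof.
rewrite /J0 /bessel; congr (limn (series _)); apply/funext => k.
rewrite /bessel_coef add0n (_ : 0`!%:R = 1 :> R)// mulr1 -expr2; congr (_ / _).
by rewrite exprM -[in RHS]mulN1r [in RHS]exprMn; congr (_ * _ ^+ k); field.
Qed.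
End normalized_bessel.

(** * The logarithmic potential *)

Section log_series.
Context {R : realType}.

(** Partial sums of the power series of -ln (1 - z), used at z = P/s, where 1 - z = |p-x|^2/s. *)
Definition log_partial (n : nat) (z : R) : R := \sum_(0 <= k < n) z ^+ k.+1 / k.+1%:R.

(** The derivative is 1/(1-t) minus the first [n] terms of the geometric series. *)
Lemma is_derive_log_remainder n (t : R) : t < 1 ->
  is_derive t 1 (fun t => - ln (1 - t) - log_partial n t) (t ^+ n / (1 - t)).
Proof.
move=> t1; elim: n => [|n ih].
  have d1 : is_derive t 1 (fun t : R => 1 - t) (-1).
    have := is_derive_ptB _ _ _ _ _ (is_derive_cst (1 : R) t (1 : R)) (is_derive_id t (1 : R)).
    by rewrite sub0r.
  have t0 : 0 < 1 - t by lra.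
  have d2 := @is_derive1_comp R (@ln R) (fun t : R => 1 - t) t _ _ (is_derive1_ln t0) d1.
  have d3 := is_derive_ptB _ _ _ _ _ (is_derive_cst (0 : R) t (1 : R)) d2.
  under eq_fun do rewrite /log_partial big_geq// subr0 -[- ln _]add0r.
  by apply: is_derive_eq d3 _; rewrite expr0 /GRing.scale/=; field; rewrite gt_eqF.
have dX : is_derive t 1 (fun t : R => t ^+ n.+1) (n.+1%:R * t ^+ n * 1).
  exact: is_derive_ptX (is_derive_id t (1 : R)).
have d := is_derive_ptB _ _ _ _ _ ih
  (is_derive_ptM _ _ _ _ _ dX (is_derive_cst (n.+1%:R^-1 : R) t (1 : R))).
have -> : (fun t => - ln (1 - t) - log_partial n.+1 t) =
    (fun t => - ln (1 - t) - log_partial n t - t ^+ n.+1 * n.+1%:R^-1).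
  by apply/funext => s; rewrite /log_partial big_nat_recr//= opprD addrA.
apply: is_derive_eq d _; rewrite /cst mulr0 addr0 mulr1 mulrAC divff ?pnatr_eq0// mul1r exprS.
by field; rewrite subr_eq0 gt_eqF.
Qed.

(** By the mean value theorem the remainder is z s^n/(1-s) for some s between 0 and z. The lower
    bound later provides domination by the logarithm, the upper bound pointwise convergence. *)
Lemma log_remainder n (z : R) : 0 <= z < 1 ->
  0 <= - ln (1 - z) - log_partial n z <= z ^+ n / (1 - z).
Proof.
move=> /andP[z0 z1].
pose f := fun t : R => - ln (1 - t) - log_partial n t.
have df (t : R) : t <= z -> is_derive t 1 f (t ^+ n / (1 - t)).
  by move=> tz; apply: is_derive_log_remainder; lra.
have d1 (t : R) : t \in `]0, z[ -> is_derive t 1 f (t ^+ n / (1 - t)).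
  by rewrite in_itv/= => /andP[_ /ltW]; exact: df.
have c1 : {within `[0, z], continuous f}.
  apply: derivable_within_continuous => t; rewrite in_itv/= => /andP[_ tz].
  by have [] := df _ tz.
have [s /[!in_itv]/= /andP[s0 sz]] := MVT_segment z0 d1 c1.
have f0 : f 0 = 0.
  rewrite /f subr0 ln1 oppr0 /log_partial big1 ?subrr// => k _.
  by rewrite expr0n mul0r.
rewrite -/(f z) f0 !subr0 => ->.
have s1 : 0 < 1 - s by lra.
have z1' : 0 < 1 - z by lra.
apply/andP; split; first by rewrite mulr_ge0// divr_ge0 ?exprn_ge0// ltW.
apply: (@le_trans _ _ (s ^+ n / (1 - s))).
  by rewrite ler_piMr ?divr_ge0 ?exprn_ge0// ltW.
apply: ler_pM.
- exact: exprn_ge0.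
- by rewrite invr_ge0 ltW.
- by apply: lerXn2r; rewrite ?nnegrE.
- by rewrite lef_pV2 ?posrE//; lra.
Qed.

Lemma cvg_log_partial (z : R) : 0 <= z < 1 ->
  (fun n => log_partial n z) @ \oo --> - ln (1 - z).
Proof.
move=> z01; have /andP[z0 z1] := z01.
have l : (fun n => - ln (1 - z) - z ^+ n / (1 - z)) @ \oo --> - ln (1 - z).
  rewrite -[X in _ --> X]subr0 -(mul0r (1 - z)^-1); apply: cvgB; first exact: cvg_cst.
  by apply: cvgM; [apply: cvg_expr; rewrite ger0_norm|exact: cvg_cst].
apply: squeeze_cvgr l (cvg_cst (- ln (1 - z))); apply: nearW => n.
by have := log_remainder n z z01; lra.
Qed.

Lemma log_partial_ge0 n (z : R) : 0 <= z -> 0 <= log_partial n z.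
Proof. by move=> z0; rewrite sumr_ge0// => k _; rewrite divr_ge0// exprn_ge0. Qed.

Lemma nondecreasing_log_partial (z : R) : 0 <= z ->
  {homo log_partial^~ z : m n / (m <= n)%N >-> m <= n}.
Proof.
move=> z0; apply/nondecreasing_seqP => n.
by rewrite /log_partial big_nat_recr//= lerDl divr_ge0// exprn_ge0.
Qed.

End log_series.

Section log_potential.
Context {R : realType}.
Implicit Types (x p : R * R) (r : R) (f g : R * R -> R).

Lemma derive_constant (a : R) (p v : R * R) : is_derive p v (fun=> a) 0.
Proof. exact: is_derive_cst. Qed.

(** For u = 1 the Laplacian vanishes and the moment identity becomes (k+2) V_(k+1) = (k+1) s V_k,
    started by the area. *)
Lemma moment_cst1 x r k : 0 < r ->
  moment x r (fun=> 1) k = pi * (r ^+ 2) ^+ k.+1 / k.+1%:R.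
Proof.
move=> r0; elim: k => [|k ih].
  rewrite expr1 divr1 -(disc_area x)//; apply: eq_Rintegral => p _.
  by rewrite expr0 mulr1.
have c a : closed_disc_continuous x r (fun=> a) by move=> p _; exact: cvg_cst.
have := moment_laplacian x r k (fun=> 1) (fun=> 0) (fun=> 0) (fun=> 0) (fun=> 0) r0
  (fun p _ => And4 (derive_constant 1 p e1) (derive_constant 0 p e1)
    (derive_constant 1 p e2) (derive_constant 0 p e2)) (c 1) (c 0) (c 0).
have -> : moment x r (fun=> 0 + 0) k.+2 = 0.
  rewrite -[RHS](mul0r (Rintegral leb2 (disc x r) (fun=> 1))) -RintegralZ_disc//.
  by apply: eq_Rintegral => p _; rewrite addr0 mulr0 mul0r.
rewrite ih => /eqP; rewrite eq_sym subr_eq0 => /eqP E.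
have k2 : k.+2%:R != 0 :> R by rewrite pnatr_eq0.
have k1 : k.+1%:R != 0 :> R by rewrite pnatr_eq0.
apply: (mulfI (_ : 4 * k.+2%:R ^+ 2 != 0)).
  by rewrite mulf_neq0 ?expf_neq0.
rewrite -E (exprS (r ^+ 2) k.+1).
move: (k.+1%:R : R) (k.+2%:R : R) (_ ^+ k.+1) k1 k2 => m l s m0 l0; field.
by rewrite m0 l0.
Qed.

Lemma closed_disc_continuous_log_partial x r f n : closed_disc_continuous x r f ->
  closed_disc_continuous x r (fun p => f p * log_partial n (power x r p / r ^+ 2)).
Proof.
move=> cf p K.
have cz : {for p, continuous (fun p => power x r p / r ^+ 2)}.
  by apply: cvgM; [exact: continuous_power|exact: cvg_cst].
have cl : {for p, continuous (fun p => log_partial n (power x r p / r ^+ 2))}.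
  elim: n => [|n ih].
    have -> : (fun p => log_partial 0 (power x r p / r ^+ 2)) = fun=> 0.
      by apply/funext => q; rewrite /log_partial big_geq.
    exact: cvg_cst.
  have -> : (fun p => log_partial n.+1 (power x r p / r ^+ 2)) =
      (fun q => log_partial n (power x r q / r ^+ 2) +
        (power x r q / r ^+ 2) ^+ n.+1 * n.+1%:R^-1).
    by apply/funext => q; rewrite /log_partial big_nat_recr.
  apply: cvgD; first exact: ih.
  by apply: cvgM; [exact: (continuous_for_exprn _ _ _ cz)|exact: cvg_cst].
by apply: cvgM; [exact: cf|exact: cl].
Qed.

Lemma Rintegral_log_partial x r f n : 0 < r -> closed_disc_continuous x r f ->
  Rintegral leb2 (disc x r) (fun p => f p * log_partial n (power x r p / r ^+ 2)) =
  \sum_(0 <= k < n) moment x r f k.+1 / (k.+1%:R * (r ^+ 2) ^+ k.+1).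
Proof.
move=> r0 cf; have r2 : r ^+ 2 != 0 by rewrite expf_neq0// gt_eqF.
elim: n => [|n ih].
  rewrite big_geq// -[RHS](mul0r (Rintegral leb2 (disc x r) f)) -RintegralZ_disc//.
  by apply: eq_Rintegral => p _; rewrite /log_partial big_geq// mulr0 mul0r.
rewrite big_nat_recr//= -ih /moment mulrC -RintegralZ_disc//; last first.
  exact: closed_disc_continuous_moment.
rewrite -RintegralD_disc//; [|exact: closed_disc_continuous_log_partial|].
  apply: eq_Rintegral => p _; rewrite /log_partial big_nat_recr//= mulrDr; congr (_ + _).
  by rewrite expr_div_n invfM; ring.
by move=> p K; apply: cvgM; [exact: cvg_cst|exact: closed_disc_continuous_moment].
Qed.

(** Here 1 - P/s is the square of |p-x|/r, whence the factor 1/2. *)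
Lemma ln_eucl_dist x r p : 0 < r -> disc x r p -> p <> x ->
  ln (r / eucl_dist x p) = - ln (1 - power x r p / r ^+ 2) / 2.
Proof.
move=> r0 xp px.
have q0 : 0 < (p.1 - x.1) ^+ 2 + (p.2 - x.2) ^+ 2.
  rewrite lt_neqAle addr_ge0 ?sqr_ge0// andbT eq_sym paddr_eq0 ?sqr_ge0//.
  apply/negP => /andP[]; rewrite !sqrf_eq0 !subr_eq0 => /eqP h1 /eqP h2.
  by apply: px; rewrite (surjective_pairing p) h1 h2 -surjective_pairing.
have r20 : 0 < r ^+ 2 by rewrite exprn_gt0.
have -> : 1 - power x r p / r ^+ 2 = eucl_dist x p ^+ 2 / r ^+ 2.
  rewrite /eucl_dist sqr_sqrtr ?(ltW q0)// /power; field.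
  by rewrite gt_eqF.
have d0 : 0 < eucl_dist x p by rewrite sqrtr_gt0.
have -> : ln (r / eucl_dist x p) = ln r - ln (eucl_dist x p) by rewrite ln_div ?posrE.
have -> : ln (eucl_dist x p ^+ 2 / r ^+ 2) = ln (eucl_dist x p) * 2 - ln r * 2.
  by rewrite ln_div ?posrE ?exprn_gt0// (lnXn 2 d0) (lnXn 2 r0) !mulr_natr.
by field.
Qed.

(** At the centre P/s equals 1 and the logarithmic series diverges. Limits are therefore taken on
    the punctured disc, which differs from the disc by a null set. *)
Lemma open_punctured_disc x r : 0 < r -> open (disc x r `\ x).
Proof.
move=> r0; apply: openI; first exact: open_disc.
apply: closed_openC; apply: accessible_closed_set1; apply: hausdorff_accessible.
exact: norm_hausdorff.
Qed.

Lemma set1_setX x : [set x] = [set x.1] `*` [set x.2].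
Proof.
apply/seteqP; split=> [y ->//|y [/= h1 h2]].
by rewrite /= (surjective_pairing y) h1 h2 -surjective_pairing.
Qed.

Lemma leb2_set1 x : leb2 [set x] = 0.
Proof.
rewrite set1_setX /leb2 product_measure1E; [|exact: measurable_set1|exact: measurable_set1].
by apply/eqP; rewrite mule_eq0; apply/orP; left; apply/eqP; exact: lebesgue_measure_set1.
Qed.

Lemma measurable_point x : measurable [set x].
Proof.
by rewrite set1_setX; apply: measurableX; exact: measurable_set1.
Qed.

Lemma unit_power x r p : 0 < r -> disc x r p -> p <> x -> 0 <= power x r p / r ^+ 2 < 1.
Proof.
move=> r0 xp px; have r20 : 0 < r ^+ 2 by rewrite exprn_gt0.
have p0 : 0 < power x r p by move: xp; rewrite discE.
rewrite divr_ge0 ?(ltW p0) ?(ltW r20)//= ltr_pdivrMr// mul1r /power gtrBl.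
rewrite lt_neqAle addr_ge0 ?sqr_ge0// andbT eq_sym paddr_eq0 ?sqr_ge0//.
apply/negP => /andP[]; rewrite !sqrf_eq0 !subr_eq0 => /eqP h1 /eqP h2.
by apply: px; rewrite (surjective_pairing p) h1 h2 -surjective_pairing.
Qed.

Lemma integral_punctured x r f : 0 < r -> leb2.-integrable (disc x r) (EFin \o f) ->
  (\int[leb2]_(p in disc x r) (f p)%:E = \int[leb2]_(p in disc x r `\ x) (f p)%:E)%E.
Proof.
move=> r0 intf; apply: negligible_integral => //.
- exact: measurable_point.
- exact: measurable_disc.
- exact: leb2_set1.
Qed.

Lemma integrable_punctured x r f : 0 < r ->
  leb2.-integrable (disc x r `\ x) (EFin \o f) -> leb2.-integrable (disc x r) (EFin \o f).
Proof.
move=> r0 intf.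
have mf : measurable_fun (disc x r) (EFin \o f).
  have -> : disc x r = disc x r `\ x `|` [set x].
    apply/seteqP; split=> [y xy|y [[]//|->]].
      by have [->|/eqP yx] := eqVneq y x; [right|left].
    by rewrite discE//= /power !subrr expr0n /= addr0 subr0 exprn_gt0.
  apply/measurable_funU; [|exact: measurable_point|].
    exact: open_measurable_plane (open_punctured_disc x r r0).
  split; first exact: measurable_int intf.
  exact: measurable_fun_set1.
move/integrableP: intf => [_ intf]; apply/integrableP; split => //.
apply: le_lt_trans intf; rewrite le_eqVlt; apply/orP; left; apply/eqP.
apply: ge0_negligible_integral => //.
- exact: measurable_point.
- exact: measurable_disc.
- exact: measurableT_comp.
- exact: leb2_set1.
Qed.

Lemma continuous_punctured_log x r p : 0 < r -> (disc x r `\ x) p ->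
  {for p, continuous (fun p => - ln (1 - power x r p / r ^+ 2))}.
Proof.
move=> r0 [xp px]; have /andP[_ z1] := unit_power x r p r0 xp px.
have cz : {for p, continuous (fun p => 1 - power x r p / r ^+ 2)}.
  apply: cvgB; first exact: cvg_cst.
  by apply: cvgM; [exact: continuous_power|exact: cvg_cst].
apply: cvgN; apply: (continuous_comp cz); apply: continuous_ln.
by rewrite subr_gt0.
Qed.

(** Monotone convergence: the partial sums increase to the logarithm, and their integrals are
    explicit moments of the constant 1 that stay below pi r^2. *)
Lemma integrable_log x r : 0 < r -> leb2.-integrable (disc x r `\ x)
  (EFin \o (fun p => - ln (1 - power x r p / r ^+ 2))).
Proof.
move=> r0; set L := fun p => - ln _.
have oD := open_punctured_disc x r r0.
have mD : measurable (disc x r `\ x) by exact: open_measurable_plane.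
have mL : measurable_fun (disc x r `\ x) L.
  by apply: continuous_measurable_plane => // p; exact: continuous_punctured_log.
pose S n p := log_partial n (power x r p / r ^+ 2).
have c1 : closed_disc_continuous x r (fun=> 1) by move=> p _; exact: cvg_cst.
have cS n : closed_disc_continuous x r (S n).
  have -> : S n = fun p => 1 * log_partial n (power x r p / r ^+ 2).
    by apply/funext => p; rewrite mul1r.
  exact: closed_disc_continuous_log_partial.
have iS n := continuous_integrable_disc x r (S n) r0 (cS n).
have z01 p : (disc x r `\ x) p -> 0 <= power x r p / r ^+ 2 < 1.
  by move=> [xp px]; exact: unit_power.
have S0 n p : (disc x r `\ x) p -> 0 <= S n p.
  by move=> /z01 /andP[z0 _]; exact: log_partial_ge0.
have L0 p : (disc x r `\ x) p -> 0 <= L p.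
  move=> /z01 z; have := log_remainder 0 _ z; rewrite /log_partial big_geq// subr0.
  by move=> /andP[].
have IS n : (\int[leb2]_(p in disc x r `\ x) (S n p)%:E <= (pi * r ^+ 2)%:E)%E.
  rewrite -(integral_punctured x r (S n) r0 (iS n)).
  have <- : (Rintegral leb2 (disc x r) (S n))%:E = (\int[leb2]_(p in disc x r) (S n p)%:E)%E.
    by rewrite /Rintegral fineK//; apply: integrable_fin_num (iS n); exact: measurable_disc.
  rewrite lee_fin.
  have -> : Rintegral leb2 (disc x r) (S n) =
      Rintegral leb2 (disc x r) (fun p => 1 * log_partial n (power x r p / r ^+ 2)).
    by apply: eq_Rintegral => p _; rewrite mul1r.
  rewrite (Rintegral_log_partial x r _ n r0 c1).
  (* The general term is pi s / ((k+1)(k+2)), so the sum telescopes to pi s (1 - 1/(n+1)). *)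
  have E k : moment x r (fun=> 1) k.+1 / (k.+1%:R * (r ^+ 2) ^+ k.+1) =
     pi * r ^+ 2 * (k.+1%:R^-1 - k.+2%:R^-1).
    rewrite moment_cst1// (exprS _ k.+1).
    have : (r ^+ 2) ^+ k.+1 != 0 by rewrite !expf_neq0// gt_eqF.
    have : 0 < k.+1%:R :> R by rewrite ltr0n.
    have -> : k.+2%:R = k.+1%:R + 1 :> R by rewrite natr1.
    move: (k.+1%:R : R) ((r ^+ 2) ^+ k.+1) => m s m0 s0; field.
    by rewrite s0 !gt_eqF//; lra.
  under eq_bigr do rewrite E.
  rewrite -mulr_sumr.
  have -> : \sum_(0 <= k < n) (k.+1%:R^-1 - k.+2%:R^-1) = 1 - n.+1%:R^-1 :> R.
    elim: n => [|n ih]; first by rewrite big_geq// invr1 subrr.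
    by rewrite big_nat_recr//= ih addrA subrK.
  by rewrite ger_pMr ?mulr_gt0 ?pi_gt0 ?exprn_gt0// gerBl invr_ge0.
have cv p : (disc x r `\ x) p -> (fun n => (S n p)%:E) @ \oo --> (L p)%:E.
  by move=> /z01 z; apply: cvg_EFin; [exact: nearW|exact: cvg_log_partial].
have mc : (fun n => \int[leb2]_(p in disc x r `\ x) (S n p)%:E)%E @ \oo -->
    (\int[leb2]_(p in disc x r `\ x) (L p)%:E)%E.
  have <- : (\int[leb2]_(p in disc x r `\ x) (limn (fun n => (S n p)%:E)) =
      \int[leb2]_(p in disc x r `\ x) (L p)%:E)%E.
    by apply: eq_integral => p; rewrite inE => /cv /cvg_lim ->.
  apply: cvg_monotone_convergence.
  - exact: mD.
  - move=> n; apply/measurable_EFinP; apply: continuous_measurable_plane => // p [xp _].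
    by apply: cS; exact: subset_closure.
  - by move=> n p Dp; rewrite lee_fin; exact: S0.
  - move=> p Dp m n mn; rewrite lee_fin; apply: nondecreasing_log_partial => //.
    by have /andP[] := z01 _ Dp.
apply/integrableP; split; first exact/measurable_EFinP.
have -> : (\int[leb2]_(p in disc x r `\ x) `|(EFin \o L) p| =
    \int[leb2]_(p in disc x r `\ x) (L p)%:E)%E.
  by apply: eq_integral => p; rewrite inE => /L0 Lp; rewrite /= ger0_norm.
rewrite -(cvg_lim _ mc)//; apply: (@le_lt_trans _ _ (pi * r ^+ 2)%:E); last exact: ltry.
apply: lime_le; first by apply/cvg_ex; eexists; exact: mc.
by apply: nearW => n; exact: IS.
Qed.

(** Dominated convergence: with [M] a bound of |f| on the closed disc, every partial sum is at most
    [M] times the integrable logarithm [L]. The 2 offsets the 1/2 of [ln_eucl_dist]. *)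
Lemma log_potential_cvg x r f : 0 < r -> closed_disc_continuous x r f ->
  (fun n => \sum_(0 <= k < n) moment x r f k.+1 / (k.+1%:R * (r ^+ 2) ^+ k.+1)) @ \oo -->
  2 * Rintegral leb2 (disc x r) (fun p => f p * ln (r / eucl_dist x p)).
Proof.
move=> r0 cf; set D := disc x r `\ x.
pose L p : R := - ln (1 - power x r p / r ^+ 2).
pose S n p := f p * log_partial n (power x r p / r ^+ 2).
have oD : open D := open_punctured_disc x r r0.
have mD : measurable D by exact: open_measurable_plane.
have cfD p : D p -> {for p, continuous f}.
  by move=> [xp _]; apply: cf; exact: subset_closure.
have cS n := closed_disc_continuous_log_partial x r f n cf.
have iL := integrable_log x r r0.
have [M M0 fM] := bounded_on_closure_disc x r f r0 cf.
have mfL : measurable_fun D (fun p => f p * L p).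
  apply: continuous_measurable_plane => // p Dp.
  by apply: cvgM; [exact: cfD|exact: continuous_punctured_log].
have z01 p : D p -> 0 <= power x r p / r ^+ 2 < 1.
  by move=> [xp px]; exact: unit_power.
have S0 n p : D p -> 0 <= log_partial n (power x r p / r ^+ 2) <= L p.
  move=> /z01 z; have /andP[z0 _] := z; rewrite log_partial_ge0//=.
  by have /andP[h _] := log_remainder n _ z; rewrite -subr_ge0.
have iML : leb2.-integrable D (fun p => M%:E * (L p)%:E)%E.
  by apply: integrableZl => //; exact: iL.
have [ifL _ cv] : [/\ leb2.-integrable D (EFin \o (fun p => f p * L p)),
    (fun n => \int[leb2]_(p in D) `|(S n p)%:E - (f p * L p)%:E|)%E @ \oo --> 0%E &
    (fun n => \int[leb2]_(p in D) (S n p)%:E)%E @ \oo -->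
      (\int[leb2]_(p in D) (f p * L p)%:E)%E].
  apply: (dominated_convergence _ _ _ _ iML) => //.
  - move=> n; apply/measurable_EFinP; apply: continuous_measurable_plane => // p [xp _].
    by apply: cS; exact: subset_closure.
  - exact/measurable_EFinP.
  - apply: aeW => p Dp; apply: cvg_EFin; first exact: nearW.
    by apply: cvgM; [exact: cvg_cst|apply: cvg_log_partial; exact: z01].
  - apply: aeW => p n Dp; rewrite lee_fin normrM.
    have /andP[h1 h2] := S0 n p Dp; rewrite (ger0_norm h1).
    by apply: ler_pM => //; apply: fM; apply: subset_closure; case: Dp.
have E2 p : D p -> f p * ln (r / eucl_dist x p) = f p * L p / 2.
  by move=> [xp px]; rewrite ln_eucl_dist// /L; ring.
have ihalf : leb2.-integrable D (EFin \o (fun p => f p * ln (r / eucl_dist x p))).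
  have : leb2.-integrable D (fun p => (2^-1)%:E * (f p * L p)%:E)%E.
    by apply: integrableZl => //; exact: ifL.
  apply: eq_integrable => //.
  by move=> p; rewrite inE => Dp /=; rewrite (E2 p Dp); congr EFin; rewrite mulrC.
have -> : 2 * Rintegral leb2 (disc x r) (fun p => f p * ln (r / eucl_dist x p)) =
    fine (\int[leb2]_(p in D) (f p * L p)%:E)%E.
  rewrite /Rintegral (integral_punctured x r _ r0 (integrable_punctured x r _ r0 ihalf)).
  have -> : (\int[leb2]_(p in D) (f p * ln (r / eucl_dist x p))%:E =
      \int[leb2]_(p in D) ((2^-1)%:E * (f p * L p)%:E))%E.
    by apply: eq_integral => p; rewrite inE => Dp; rewrite E2// mulrC.
  rewrite integralZl//; try exact: ifL.
  rewrite fineM//; last by apply: integrable_fin_num (ifL); exact: mD.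
  by rewrite /= mulrA divff ?mul1r.
have -> : (fun n => \sum_(0 <= k < n) moment x r f k.+1 / (k.+1%:R * (r ^+ 2) ^+ k.+1)) =
    (fun n => fine (\int[leb2]_(p in D) (S n p)%:E)%E).
  apply/funext => n; rewrite -Rintegral_log_partial// /Rintegral.
  by rewrite -(integral_punctured x r _ r0 (continuous_integrable_disc x r _ r0 (cS n))).
have fin : (\int[leb2]_(p in D) (f p * L p)%:E)%E \is a fin_num.
  by apply: integrable_fin_num (ifL); exact: mD.
by apply: fine_cvg; rewrite fineK.
Qed.

End log_potential.

(** * Concentration at the centre *)

Section concentration.
Context {R : realType}.
Implicit Types (x p : R * R) (r : R) (f g : R * R -> R).

Lemma le_moment x r f g k : 0 < r ->
  closed_disc_continuous x r f -> closed_disc_continuous x r g ->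
  (forall p, disc x r p -> f p <= g p) -> moment x r f k <= moment x r g k.
Proof.
move=> r0 cf cg fg; rewrite /moment; apply: le_Rintegral.
- exact: measurable_disc.
- by apply: continuous_integrable_disc => //; exact: closed_disc_continuous_moment.
- by apply: continuous_integrable_disc => //; exact: closed_disc_continuous_moment.
- move=> p xp; apply: ler_wpM2l; last exact: fg.
  by apply: exprn_ge0; move: xp; rewrite discE// => /ltW.
Qed.

Lemma momentD x r f g k : 0 < r ->
  closed_disc_continuous x r f -> closed_disc_continuous x r g ->
  moment x r (fun p => f p + g p) k = moment x r f k + moment x r g k.
Proof.
move=> r0 cf cg; rewrite /moment -RintegralD_disc//; try exact: closed_disc_continuous_moment.
by apply: eq_Rintegral => p _; rewrite mulrDr.
Qed.

Lemma momentZ x r f a k : 0 < r -> closed_disc_continuous x r f ->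
  moment x r (fun p => a * f p) k = a * moment x r f k.
Proof.
move=> r0 cf; rewrite /moment -RintegralZ_disc//; last exact: closed_disc_continuous_moment.
by apply: eq_Rintegral => p _; rewrite mulrCA.
Qed.

(** Near the centre this is continuity; at distance at least d the crude bound 2M is at most
    (2M/d^2) |p-x|^2. The right-hand side is built from 1 and s - P because their moments are
    explicit. *)
Lemma near_center_bound x r f e : 0 < r -> 0 < e -> closed_disc_continuous x r f ->
  exists2 C, 0 <= C & forall p, disc x r p ->
    `|f p - f x| <= e + C * (r ^+ 2 - power x r p).
Proof.
move=> r0 e0 cf; have [M M0 fM] := bounded_on_closure_disc x r f r0 cf.
have xx : closure (disc x r) x.
  by apply: subset_closure; rewrite discE//= /power !subrr expr0n /= addr0 subr0 exprn_gt0.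
have /cvgrPdist_lt /(_ e e0) /nbhs_ballP[d /= d0 dP] := cf x xx.
have d20 : 0 < d ^+ 2 by rewrite exprn_gt0.
have C0 : 0 <= 2 * M / d ^+ 2 by apply: divr_ge0; [apply: mulr_ge0|]; exact: ltW.
exists (2 * M / d ^+ 2) => //.
move=> p xp.
have q1 : 0 <= (p.1 - x.1) ^+ 2 by exact: sqr_ge0.
have q2 : 0 <= (p.2 - x.2) ^+ 2 by exact: sqr_ge0.
have -> : r ^+ 2 - power x r p = (p.1 - x.1) ^+ 2 + (p.2 - x.2) ^+ 2 by rewrite /power; ring.
have [pd|pd] := pselect (ball x d p).
  by rewrite distrC (le_trans (ltW (dP _ pd)))// lerDl mulr_ge0 ?addr_ge0.
(* [ball] refers to the max-norm; it contains the Euclidean disc of radius d, so a point outside it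
   is at Euclidean distance at least d. *)
have dq : d ^+ 2 <= (p.1 - x.1) ^+ 2 + (p.2 - x.2) ^+ 2.
  rewrite leNgt; apply/negP => h; apply: pd; split; rewrite /ball /= distrC.
    by rewrite -(ger0_norm (ltW d0)) -ltr_sqr ?nnegrE// !real_normK ?num_real//; lra.
  by rewrite -(ger0_norm (ltW d0)) -ltr_sqr ?nnegrE// !real_normK ?num_real//; lra.
have h1 := fM p (subset_closure xp); have h2 := fM x xx.
apply: (@le_trans _ _ (2 * M)).
  by rewrite (le_trans (ler_normB _ _))//; lra.
apply: (@le_trans _ _ (2 * M / d ^+ 2 * d ^+ 2)).
  by rewrite divfK// gt_eqF.
apply: (@le_trans _ _ (2 * M / d ^+ 2 * ((p.1 - x.1) ^+ 2 + (p.2 - x.2) ^+ 2))).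
  by rewrite ler_wpM2l.
by rewrite lerDr ltW.
Qed.

(** Under the probability density proportional to P^k, the mean of |p-x|^2 is s/(k+2). Its decay is
    what makes the weights concentrate. *)
Lemma moment_power x r k : 0 < r ->
  moment x r (fun p => r ^+ 2 - power x r p) k =
  moment x r (fun=> 1) k * (r ^+ 2 / k.+2%:R).
Proof.
move=> r0; have c1 : closed_disc_continuous x r (fun=> 1) by move=> p _; exact: cvg_cst.
have cp : closed_disc_continuous x r (power x r) by move=> p _; exact: continuous_power.
have -> : moment x r (fun p => r ^+ 2 - power x r p) k =
    moment x r (fun p => r ^+ 2 * 1 + (-1) * power x r p) k.
  by apply: eq_Rintegral => p _; rewrite mulr1 mulN1r.
rewrite momentD//; first last.
- by move=> p K; apply: cvgM; [exact: cvg_cst|exact: cp].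
- by move=> p K; apply: cvgM; exact: cvg_cst.
rewrite !momentZ//.
have -> : moment x r (power x r) k = moment x r (fun=> 1) k.+1.
  by apply: eq_Rintegral => p _; rewrite mulr1 exprSr.
rewrite !moment_cst1// (exprS _ k.+1).
have k1 : k.+2%:R = k.+1%:R + 1 :> R by rewrite natr1.
have k0 : 0 < k.+1%:R :> R by rewrite ltr0n.
rewrite k1; move: (k.+1%:R : R) k0 ((r ^+ 2) ^+ k.+1) => m m0 s; field.
by rewrite !gt_eqF//; lra.
Qed.

Lemma moment_cst1_gt0 x r k : 0 < r -> 0 < moment x r (fun=> 1) k.
Proof.
by move=> r0; rewrite moment_cst1// divr_gt0 ?ltr0n// mulr_gt0 ?pi_gt0// !exprn_gt0.
Qed.

(** A Chebyshev-type argument: integrating the bound of [near_center_bound] against the normalized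
    weight gives an error of at most e/2 + C s/(k+2). *)
Lemma moment_concentration x r f : 0 < r -> closed_disc_continuous x r f ->
  (fun k => moment x r f k / moment x r (fun=> 1) k) @ \oo --> f x.
Proof.
move=> r0 cf; apply/cvgrPdist_le => e e0.
have c a : closed_disc_continuous x r (fun=> a) by move=> p _; exact: cvg_cst.
have e20 : 0 < e / 2 by rewrite divr_gt0.
have [C C0 fC] := near_center_bound x r f (e / 2) r0 e20 cf.
have cg a b : closed_disc_continuous x r (fun p => a * 1 + b * (r ^+ 2 - power x r p)).
  move=> p K; apply: cvgD; first exact: cvg_cst.
  apply: cvgM; first exact: cvg_cst.
  by apply: cvgB; [exact: cvg_cst|exact: continuous_power].
have cq : closed_disc_continuous x r (fun p => r ^+ 2 - power x r p).
  by move=> p K; apply: cvgB; [exact: cvg_cst|exact: continuous_power].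
have mg a b k : moment x r (fun p => a * 1 + b * (r ^+ 2 - power x r p)) k =
    (a + b * (r ^+ 2 / k.+2%:R)) * moment x r (fun=> 1) k.
  have ca : closed_disc_continuous x r (fun=> a * 1) by exact: c.
  have cb : closed_disc_continuous x r (fun p => b * (r ^+ 2 - power x r p)).
    by move=> p K; apply: cvgM; [exact: cvg_cst|exact: cq].
  rewrite (momentD x r _ _ k r0 ca cb) (momentZ x r (fun=> 1) a k r0 (c 1)).
  by rewrite (momentZ x r _ b k r0 cq) moment_power//; ring.
have bound k : `|f x - moment x r f k / moment x r (fun=> 1) k| <= e / 2 + C * r ^+ 2 * k.+1%:R^-1.
  have N0 := moment_cst1_gt0 x r k r0.
  apply: (@le_trans _ _ (e / 2 + C * (r ^+ 2 / k.+2%:R))); last first.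
    rewrite lerD2l mulrA ler_wpM2l//; first by rewrite mulr_ge0// sqr_ge0.
    by rewrite lef_pV2 ?posrE ?ltr0n// ler_nat.
  rewrite distrC ler_distl ler_pdivlMr// ler_pdivrMr//; apply/andP; split.
    have -> : f x - (e / 2 + C * (r ^+ 2 / k.+2%:R)) =
      (f x - e / 2) + (- C) * (r ^+ 2 / k.+2%:R) by ring.
    rewrite -mg; apply: le_moment => // p /fC; rewrite ler_distl => /andP[h _].
    by move: h; rewrite mulr1 mulNr; lra.
  have -> : f x + (e / 2 + C * (r ^+ 2 / k.+2%:R)) =
    (f x + e / 2) + C * (r ^+ 2 / k.+2%:R) by ring.
  rewrite -mg; apply: le_moment => // p /fC; rewrite ler_distl => /andP[_ h].
  by move: h; rewrite mulr1; lra.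
have l : (fun k => C * r ^+ 2 * k.+1%:R^-1) @ \oo --> C * r ^+ 2 * 0.
  by apply: cvgM; [exact: cvg_cst|exact: cvg_harmonic].
rewrite mulr0 in l; move/cvgrPdist_le : l => /(_ _ e20) [N _ NP].
exists N => // k Nk; apply: (le_trans (bound k)).
have := NP k Nk; rewrite /= sub0r normrN => h.
by rewrite [leRHS]splitr lerD2l (le_trans (ler_norm _) h).
Qed.

End concentration.

(** * The mean value formula *)

Lemma metaharmonic_moment_rec {R : realType} (D : set (R * R)) (lambda : R)
  (u : R * R -> R) (x : R * R) (r : R) (k : nat) :
  metaharmonic D lambda u -> 0 < r -> closure (disc x r) `<=` D ->
  - lambda ^+ 2 * moment x r u k.+2 =
  4 * k.+2%:R * k.+1%:R * r ^+ 2 * moment x r u k - 4 * k.+2%:R ^+ 2 * moment x r u k.+1.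
Proof.
move=> [l0 [C2 lap]] r0 KD.
have cu : closed_disc_continuous x r u.
  by move=> p /KD /C2[du _ _ _]; exact: differentiable_continuous.
rewrite -(moment_laplacian x r k u (partial1 u) (partial1 (partial1 u))
  (partial2 u) (partial2 (partial2 u)) r0).
- rewrite -momentZ//; apply: eq_Rintegral => p; rewrite inE => /subset_closure /KD /lap.
  by rewrite /laplacian => h; congr (_ * _); lra.
- move=> p /KD /C2[du d1 d2 _]; split; apply: DeriveDef => //; exact: diff_derivable.
- exact: cu.
- by move=> p /KD /C2[_ _ _ []].
- by move=> p /KD /C2[_ _ _ []].
Qed.

(** The normalized moments and u(x) b_(k+1) satisfy the same linear recurrence and have the same
    limit u(x), so their difference is a null solution. For k = 0 this is the area mean value
    formula with factor 2 J_1(lambda r)/(lambda r). *)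
Lemma metaharmonic_moment {R : realType} (D : set (R * R)) (lambda : R)
  (u : R * R -> R) (x : R * R) (r : R) (k : nat) :
  metaharmonic D lambda u -> 0 < r -> closure (disc x r) `<=` D ->
  moment x r u k = moment x r (fun=> 1) k * (u x * bessel ((lambda * r) ^+ 2 / 4) k.+1).
Proof.
move=> mu r0 KD; set c := (lambda * r) ^+ 2 / 4.
have c0 : 0 <= c by rewrite divr_ge0// sqr_ge0.
have cu : closed_disc_continuous x r u.
  by move=> p /KD; case: mu => _ [C2 _] /C2[du _ _ _]; exact: differentiable_continuous.
pose a n := moment x r u n / moment x r (fun=> 1) n.
have N0 n : moment x r (fun=> 1) n != 0 by rewrite gt_eqF// moment_cst1_gt0.
have r20 : r ^+ 2 != 0 by rewrite expf_neq0// gt_eqF.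
have arec n : a n = a n.+1 - c / (n.+2%:R * n.+3%:R) * a n.+2.
  have := metaharmonic_moment_rec D lambda u x r n mu r0 KD.
  have VE m : moment x r u m = a m * moment x r (fun=> 1) m by rewrite divfK.
  rewrite !VE !moment_cst1// (exprS _ n.+2) (exprS _ n.+1) /c.
  have n1 : 0 < n.+1%:R :> R by rewrite ltr0n.
  have -> : n.+3%:R = n.+1%:R + 2 :> R by rewrite -natrD addn2.
  have -> : n.+2%:R = n.+1%:R + 1 :> R by rewrite natr1.
  have s0 : (r ^+ 2) ^+ n.+1 != 0 by rewrite expf_neq0.
  have p0 : pi != 0 :> R by rewrite gt_eqF// pi_gt0.
  move: (n.+1%:R : R) n1 ((r ^+ 2) ^+ n.+1) s0 (a n) (a n.+1) (a n.+2) => m m0 s s0 x0 x1 x2 E.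
  (* With m = n+1, this is the coefficient of [a n] in the moment recurrence once the explicit
     moments of 1 are inserted. *)
  apply: (mulfI (_ : 4 * (m + 1) * r ^+ 2 * pi * s != 0)).
    by rewrite !mulf_neq0// gt_eqF//; lra.
  have -> : 4 * (m + 1) * r ^+ 2 * pi * s * x0 =
      4 * (m + 1) * m * r ^+ 2 * (x0 * (pi * s / m)) by field; rewrite gt_eqF.
  have := congr1 (fun z => z + 4 * (m + 1) ^+ 2 * (x1 * (pi * (r ^+ 2 * s) / (m + 1)))) E.
  rewrite subrK => <-; field.
  by rewrite !gt_eqF//; lra.
pose d n := a n - u x * bessel c n.+1.
(* The true coefficient c/((n+2)(n+3)) is relaxed to the form required by [recurrence_cvg0_eq0]. *)
have drec n : `|d n - d n.+1| <= c / (n.+1%:R * n.+2%:R) * `|d n.+2|.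
  have -> : d n - d n.+1 = - (c / (n.+2%:R * n.+3%:R)) * d n.+2.
    have := bessel_rec c n.+1 => h.
    have -> : d n - d n.+1 = (a n - a n.+1) - u x * (bessel c n.+1 - bessel c n.+2).
      by rewrite /d; ring.
    by rewrite h arec /d; ring.
  rewrite normrM normrN; apply: ler_wpM2r => //.
  rewrite ger0_norm; last by apply: divr_ge0 => //; apply: mulr_ge0.
  apply: ler_wpM2l => //; rewrite lef_pV2 ?posrE ?mulr_gt0 ?ltr0n//.
  by apply: ler_pM; rewrite ?ler0n// ler_nat.
have dl : d @ \oo --> 0.
  rewrite -(subrr (u x)); apply: cvgB; first exact: moment_concentration.
  rewrite -[X in _ --> X]mulr1; apply: cvgM; first exact: cvg_cst.
  by rewrite (cvg_shiftS (bessel c) (nbhs (1 : R))); exact: cvg_bessel_index.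
have := recurrence_cvg0_eq0 d c c0 drec dl k.
by move=> /eqP; rewrite subr_eq0 => /eqP <-; rewrite mulrC divfK.
Qed.

Theorem theorem5p2 (R : realType) (D : set (R * R)) (lambda : R)
  (u : R * R -> R) :
  domain D -> metaharmonic D lambda u ->
  forall (x : R * R) (r : R), D x -> 0 < r -> closure (disc x r) `<=` D ->
  atilde (lambda * r) * u x =
    (pi * r ^+ 2)^-1 *
    Rintegral leb2 (disc x r) (fun y => u y * ln (r / eucl_dist x y)).
Proof.
move=> domD mu x r Dx r0 KD; have [l0 _] := mu.
set c := (lambda * r) ^+ 2 / 4.
have lr : lambda * r != 0 by rewrite mulf_neq0// gt_eqF.
have c0 : c != 0 by rewrite mulf_neq0// expf_neq0.
have r20 : r ^+ 2 != 0 by rewrite expf_neq0// gt_eqF.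
have p0 : pi != 0 :> R by rewrite gt_eqF// pi_gt0.
have cu : closed_disc_continuous x r u.
  by move=> p /KD; case: mu => _ [C2 _] /C2[du _ _ _]; exact: differentiable_continuous.
pose I := Rintegral leb2 (disc x r) (fun y => u y * ln (r / eucl_dist x y)).
(* The n-th term is pi s u(x) b_(n+2)/((n+1)(n+2)), which by [bessel_rec] equals (pi s u(x)/c)
   (b_(n+1) - b_n); dividing by c uses lambda <> 0. *)
have lim1 : (fun n => pi * r ^+ 2 * u x / c * (bessel c n - bessel c 0)) @ \oo --> 2 * I.
  have := log_potential_cvg x r u r0 cu.
  set F := (X in X @ \oo --> _ -> _); set G := (X in _ -> X @ \oo --> _).
  suff -> : F = G by [].
  apply/funext => n; rewrite /F /G {F G}.
  elim: n => [|n ih]; first by rewrite big_geq// subrr mulr0.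
  rewrite big_nat_recr//= ih (metaharmonic_moment D lambda u x r _ mu r0 KD) moment_cst1// -/c.
  have -> : bessel c n.+1 = bessel c n + c / (n.+1%:R * n.+2%:R) * bessel c n.+2.
    by rewrite -[bessel c n](subrK (bessel c n.+1)) bessel_rec; ring.
  rewrite (exprS _ n.+1); have -> : n.+2%:R = n.+1%:R + 1 :> R by rewrite natr1.
  have s0 : (r ^+ 2) ^+ n.+1 != 0 by rewrite expf_neq0.
  have m0 : 0 < n.+1%:R :> R by rewrite ltr0n.
  move: (n.+1%:R : R) m0 ((r ^+ 2) ^+ n.+1) s0 => m m0 s s0.
  move: (r ^+ 2) (bessel c n) (bessel c n.+2) (bessel c 0) => q b b2 b0.
  move: c c0 {lr ih} => C C0; field.
  by rewrite s0 C0 !gt_eqF//; lra.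
have lim2 : (fun n => pi * r ^+ 2 * u x / c * (bessel c n - bessel c 0)) @ \oo -->
    pi * r ^+ 2 * u x / c * (1 - bessel c 0).
  by apply: cvgM; [exact: cvg_cst|apply: cvgB; [exact: cvg_bessel_index|exact: cvg_cst]].
have E := cvg_unique (@Rhausdorff R) lim1 lim2.
(* The two limits give I = pi s u(x) (1 - b_0)/(2c), and (1 - b_0)/(2c) is [atilde (lambda * r)]
   because (lambda r)^2 = 4c. *)
rewrite -/I (_ : I = pi * r ^+ 2 * u x / c * (1 - bessel c 0) / 2); last first.
  by rewrite -E; field.
rewrite /atilde J0E -/c; move: (pi : R) p0 (bessel c 0) => P P0 b; rewrite /c; field.
by rewrite P0 l0 gt_eqF.
Qed.
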